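(* There exists a robot (finite automaton with a generator of random bits) with no stones and no flags ($n=0$, $M=\varnothing$) that covers $\mathbb{Z}^2$, and there is no robot with no stones and no flags that covers $\mathbb{Z}^3$.
   Context: Fix $k\ge 1$, let $G=\mathbb{Z}^k$ (with neutral element $0$), let $D=\{e_1,-e_1,\dots,e_k,-e_k\}$ where $e_1,\dots,e_k$ is the standard basis, let $n\ge 0$ be an integer (the number of stones) and let $M\subseteq G$ (the set of flagged cells). Elements of $G$ are called cells. A robot (finite automaton with a generator of random bits) with $n$ stones consists of a finite set $Q$ of states, an initial state $q_0\in Q$, a transition function $\delta: Q\times\{0,1\}^{n+2}\to Q$, and, for each $q\in Q$, a move $(d(q),p(q))\in D\times\{0,1\}^n$. The random bits $\xi_1,\xi_2,\dots$ are independent with $P(\xi_i=0)=P(\xi_i=1)=\tfrac12$. A configuration is a tuple $(a,s_1,\dots,s_n,t,q)$ with $a\in G$ (position of the robot), $s_i\in G$ (positions of the stones), $t\in\mathbb{N}$ (number of the step) and $q\in Q$. The initial configuration is $(0,0,\dots,0,1,q_0)$, so the robot and all stones start at $0$. From $(a,s_1,\dots,s_n,t,q)$ with $(d,p)=(d(q),p(q))$ the system passes to $(a',s_1',\dots,s_n',t+1,q')$, where $a'=a+d$; $s_i'=s_i+d$ if the $i$-th bit of $p$ is $1$ and $s_i=a$, and $s_i'=s_i$ otherwise; and $q'=\delta(q,w)$, where $w\in\{0,1\}^{n+2}$ is the vector whose $i$-th bit ($1\le i\le n$) is $1$ if and only if $s_i=a$, whose $(n+1)$-st bit is $1$ if and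 only if $a\in M$, and whose $(n+2)$-nd bit is $\xi_t$. The robot covers $G$ if for every cell $x\in G$ the probability that the robot is at $x$ at some step equals $1$. *)

(* Defs.v *)
From HB Require Import structures.
From mathcomp Require Import all_boot all_order all_algebra.
From mathcomp Require Import finmap.
From mathcomp Require Import all_classical all_reals all_analysis.

Set Implicit Arguments.
Unset Strict Implicit.
Unset Printing Implicit Defensive.

Import Order.TTheory GRing.Theory Num.Theory.

Local Open Scope classical_set_scope.
Local Open Scope ring_scope.

Notation cell k := 'rV[int]_k.

Definition unit_moves (k : nat) : set (cell k) :=
  [set e | exists i : 'I_k, e = delta_mx 0 i \/ e = - delta_mx 0 i].

(* [rb_dir q] and [rb_carry q] are the two components of the move attached to
   the state [q]: the direction, and the bits saying which stones to carry. *)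
Record robot (k n : nat) := Robot {
  rb_state : finType;
  rb_init : rb_state;
  rb_trans : rb_state -> n.+2.-tuple bool -> rb_state;
  rb_dir : rb_state -> cell k;
  rb_carry : rb_state -> n.-tuple bool;
  rb_dirP : forall q, unit_moves (rb_dir q)
}.

Record config (k n : nat) (r : robot k n) := Config {
  cf_pos : cell k;
  cf_stones : n.-tuple (cell k);
  cf_time : nat;
  cf_state : rb_state r
}.

Section Dynamics.
Variables (k n : nat) (M : set (cell k)) (r : robot k n).

Definition init_config : config r :=
  @Config k n r 0 [tuple 0 | i < n] 1 (rb_init r).

(* The stone bits first, then the flag bit, then the random bit. *)
Definition observation (c : config r) (b : bool) : n.+2.-tuple bool :=
  [tuple of rcons (rcons [tuple tnth (cf_stones c) i == cf_pos c | i < n]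
                         (cf_pos c \in M)) b].

(* [bits t] is the random bit read at step [t]; as [cf_time] starts at 1, the
   value [bits 0] is never read. *)
Definition step (bits : nat -> bool) (c : config r) : config r :=
  let a := cf_pos c in
  let q := cf_state c in
  let s := cf_stones c in
  @Config k n r
    (a + rb_dir q)
    [tuple if tnth (rb_carry q) i && (tnth s i == a)
           then tnth s i + rb_dir q else tnth s i | i < n]
    (cf_time c).+1
    (rb_trans q (observation c (bits (cf_time c)))).

Definition run (bits : nat -> bool) (m : nat) : config r :=
  iter m (step bits) init_config.

End Dynamics.

Section Probability.
Context (R : realType) (d : measure_display) (T : measurableType d).
Variable P : probability T R.

Definition mutually_independent (d' : measure_display) (U : measurableType d')
    (D : set nat) (X : nat -> {mfun T >-> U}) : Prop :=
  forall (J : {fset nat}) (A : nat -> set U),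
    [set` J] `<=` D -> (forall i, measurable (A i)) ->
    P (\bigcap_(i in [set` J]) (X i @^-1` A i)) =
    (\prod_(i <- J) P (X i @^-1` A i))%E.

(* The random bits are indexed from 1; nothing is required of [xi 0]. *)
Definition random_bits (xi : nat -> {mfun T >-> bool}) : Prop :=
  mutually_independent [set t | (0 < t)%N] xi /\
  forall t, (0 < t)%N -> forall b : bool, P (xi t @^-1` [set b]) = (2^-1)%:E.

Definition covers (k n : nat) (M : set (cell k)) (r : robot k n)
    (xi : nat -> {mfun T >-> bool}) : Prop :=
  forall x : cell k,
    P [set w | exists m : nat, cf_pos (run M r (fun t => xi t w) m) = x] = 1%E.

End Probability.

(* Main.v *)
Require Import Defs.
From HB Require Import structures.
From mathcomp Require Import all_boot all_order all_algebra.
From mathcomp Require Import finmap.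
From mathcomp Require Import all_classical all_reals all_analysis.
From mathcomp Require Import ring lra zify.

(** Plane. Each block of four moves of the robot shifts it by an independent
    uniform vector [(±1, ±1)], that is, by two independent simple walks on the
    line. The chance to be back after [2n] blocks is ['C(2n, n)^2 / 16^n], at
    least [1 / (4n)], so the Green function at the origin diverges. As the
    truncated Green functions satisfy [G_n(a) <= P_a(hit 0 within n) G_n(0)], the
    origin is hit almost surely from its neighbours, hence from every cell of
    the lattice spanned by the steps; the excursion to [e_1] and back that opens
    a block reaches the other cells.

    Space. Let [q] be a state that can be reached again from every state
    reachable from it, and call loop a word of bits leading from [q] to [q].
    If a nonzero linear form [f] takes on loops values proportional to their
    lengths, then after [t] steps [f] is [c t + O(1)], and cells far away on the
    side opposite to the drift are never visited. Otherwise there are three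
    pairs of loops [(u_i, v_i)] of equal lengths whose differences of
    displacements [D_i] are linearly independent. Cut time into blocks of length
    [|u_1| + |u_2| + |u_3|]. A block that starts in [q] and spells a word
    [x_1 x_2 x_3] with [x_i] in [{u_i, v_i}] is a switch: its eight possible
    values are equally likely, lead to the same state at the same time, and
    shift the rest of the path by [sum_i eps_i D_i]. Given that there are [n]
    switches, a cell is thus occupied with probability [O((n + 1)^(-3/2))].
    Since switches recur after a time of bounded mean, the sum over time of the
    expectations of these bounds converges, uniformly in the cell, so a
    sufficiently far cell is hit with probability at most [1/2]. *)

Set Implicit Arguments.
Unset Strict Implicit.
Unset Printing Implicit Defensive.

Import Order.TTheory GRing.Theory Num.Theory.

Local Open Scope ring_scope.

(** * Averages over words of bits *)

Fixpoint words (n : nat) : seq (seq bool) :=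
  if n is m.+1 then map (cons true) (words m) ++ map (cons false) (words m)
  else [:: [::]].

Lemma cons_inj (T : Type) (x : T) : injective (cons x).
Proof. by move=> u v []. Qed.

Lemma mem_words n w : (w \in words n) = (size w == n).
Proof.
elim: n w => [|n IH] [|b w] //=; rewrite mem_cat.
  by apply/negbTE/negP => /orP[] /mapP[].
rewrite eqSS -IH; case: b; rewrite (mem_map (@cons_inj _ _)).
  by apply/orP/idP => [[|/mapP[]]|]; by [|left].
by apply/orP/idP => [[/mapP[]|]|]; by [|right].
Qed.

Lemma uniq_words n : uniq (words n).
Proof.
elim: n => //= n IH; rewrite cat_uniq !map_inj_uniq ?IH //=; try exact: cons_inj.
by rewrite andbT; apply/hasPn => w /mapP[u _ ->]; apply/negP => /mapP[].
Qed.

Lemma size_words n : size (words n) = (2 ^ n)%N.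
Proof. by elim: n => //= n IH; rewrite size_cat !size_map IH expnS; lia. Qed.

Section Average.
Variable R : realFieldType.
Implicit Types F G : seq bool -> R.

Definition average n F : R := (\sum_(w <- words n) F w) / 2 ^+ n.

Lemma average0 F : average 0 F = F [::].
Proof. by rewrite /average big_seq1 expr0 divr1. Qed.

Lemma averageS n F :
  average n.+1 F =
  (average n (fun w => F (true :: w)) + average n (fun w => F (false :: w))) / 2.
Proof.
rewrite /average /= big_cat !big_map /= exprS.
have h : (2 ^+ n : R) != 0 by rewrite expf_neq0 // pnatr_eq0.
by field.
Qed.

Lemma eq_average n F G : (forall w, size w = n -> F w = G w) -> average n F = average n G.
Proof.
by move=> FG; congr (_ / _); apply: eq_big_seq => w; rewrite mem_words => /eqP /FG.
Qed.

Lemma average_cat m n F :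
  average (m + n) F = average m (fun u => average n (fun v => F (u ++ v))).
Proof. by elim: m F => [|m IH] F; rewrite ?average0 // addSn !averageS !IH. Qed.

Lemma le_average n F G :
  (forall w, size w = n -> F w <= G w) -> average n F <= average n G.
Proof.
move=> FG; rewrite ler_pM2r ?invr_gt0 ?exprn_gt0 // big_seq [leRHS]big_seq.
by apply: ler_sum => w; rewrite mem_words => /eqP /FG.
Qed.

Lemma average_cst n (c : R) : average n (fun=> c) = c.
Proof. by elim: n => [|n IH]; rewrite ?average0 // averageS !IH; field. Qed.

Lemma average_ge0 n F : (forall w, 0 <= F w) -> 0 <= average n F.
Proof. by move=> F0; rewrite -[leLHS](average_cst n); apply: le_average. Qed.

Lemma average_sum n I (r : seq I) (P : pred I) (F : I -> seq bool -> R) :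
  average n (fun w => \sum_(i <- r | P i) F i w) = \sum_(i <- r | P i) average n (F i).
Proof. by rewrite /average exchange_big mulr_suml. Qed.

Lemma averageD n F G :
  average n (fun w => F w + G w) = average n F + average n G.
Proof. by rewrite /average big_split mulrDl. Qed.

Lemma averageZ n (c : R) F : average n (fun w => c * F w) = c * average n F.
Proof. by rewrite /average -mulr_sumr mulrA. Qed.

(** The words that begin with [u] are a fraction [2 ^- size u] of all words, and the others
    contribute nonnegative terms. *)
Lemma average_prefix (u : seq bool) n F : (forall w, 0 <= F w) ->
  average n (fun v => F (u ++ v)) / 2 ^+ size u <= average (size u + n) F.
Proof.
move=> F0; rewrite average_cat {2}/average ler_pM2r ?invr_gt0 ?exprn_gt0 //.
rewrite (perm_big (u :: rem u (words (size u)))) ?big_cons; last first.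
  by apply: perm_to_rem; rewrite mem_words.
by rewrite lerDl sumr_ge0 // => w _; apply: average_ge0.
Qed.

Lemma average_indicator n (w0 : seq bool) : size w0 = n ->
  average n (fun w => (w == w0)%:R) = (2 ^+ n)^-1 :> R.
Proof.
move=> sw; rewrite /average (bigD1_seq w0) ?uniq_words ?mem_words ?sw //= eqxx.
by rewrite big1 ?addr0 ?mul1r // => w /negbTE ->.
Qed.

Lemma average_le_gap n (w0 : seq bool) (F : seq bool -> R) (b c : R) : size w0 = n ->
  (forall w, size w = n -> F w <= b) -> F w0 <= b - c ->
  average n F <= b - c / 2 ^+ n.
Proof.
move=> sw Fb Fw0; apply: (@le_trans _ _ (average n (fun w => b + - c * (w == w0)%:R))).
  apply: le_average => w wn; case: eqP => [->|_]; first by rewrite mulr1.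
  by rewrite mulr0 addr0 Fb.
by rewrite averageD averageZ average_cst average_indicator // mulNr.
Qed.

End Average.

(** * Walks steered by a finite automaton that reads random bits *)

Section Walk.
Variables (S : finType) (next : S -> bool -> S) (V : zmodType) (dir : S -> V).
Implicit Types (s : S) (u v w : seq bool) (a x : V).

Definition endstate s w := foldl next s w.

Fixpoint disp s w : V :=
  if w is b :: w' then dir s + disp (next s b) w' else 0.

Fixpoint visits x s a w : bool :=
  (a == x) || (if w is b :: w' then visits x (next s b) (a + dir s) w' else false).

Lemma endstate_cat s u v : endstate s (u ++ v) = endstate (endstate s u) v.
Proof. exact: foldl_cat. Qed.

Lemma disp_cat s u v : disp s (u ++ v) = disp s u + disp (endstate s u) v.
Proof. by elim: u s => [|b u IH] s /=; rewrite ?add0r // IH addrA. Qed.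

Lemma visits_cat x s a u v :
  visits x s a (u ++ v) =
  visits x s a u || visits x (endstate s u) (a + disp s u) v.
Proof.
elim: u s a => [|b u IH] s a /=; last by rewrite IH orbA addrA.
by rewrite addr0; case: v => [|b v] /=; case: (a == x).
Qed.

Lemma visitsP x s a w :
  reflect (exists2 t, (t <= size w)%N & a + disp s (take t w) = x) (visits x s a w).
Proof.
apply: (iffP idP) => [|[t]].
  elim: w s a => [|b w IH] s a /=.
    by rewrite orbF => /eqP<-; exists 0%N; rewrite ?addr0.
  case/orP => [/eqP<-|/IH[t tw <-]]; first by exists 0%N; rewrite ?addr0.
  by exists t.+1; rewrite //= addrA.
elim: w s a t => [|b w IH] s a [|t] //=; rewrite ?addr0.
- by move=> _ ->; rewrite eqxx.
- by move=> _ ->; rewrite eqxx.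
by rewrite ltnS addrA => /IH h /h ->; rewrite orbT.
Qed.

Section Probabilities.
Variable R : realFieldType.

Definition at_prob t x s a : R := average t (fun w => (a + disp s w == x)%:R).
Definition hit_prob t x s a : R := average t (fun w => (visits x s a w)%:R).

Lemma hit_probS_ge t x s a :
  (hit_prob t x (next s true) (a + dir s) + hit_prob t x (next s false) (a + dir s)) / 2
  <= hit_prob t.+1 x s a.
Proof.
rewrite /hit_prob averageS /= ler_pM2r ?invr_gt0 //.
by apply: lerD; apply: le_average => w _; rewrite ler_nat; case: (a == x); case: visits.
Qed.

(** Union bound over the times from 0 to [t], obtained by decomposing at the first step. *)
Lemma hit_prob_le_green t x s a : hit_prob t x s a <= \sum_(i < t.+1) at_prob i x s a.
Proof.
elim: t s a => [|t IH] s a.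
  by rewrite big_ord1 /hit_prob /at_prob !average0 /= orbF addr0.
rewrite big_ord_recl {1}/at_prob average0 /= addr0.
have -> : \sum_(i < t.+1) at_prob (bump 0 i) x s a =
    (\sum_(i < t.+1) at_prob i x (next s true) (a + dir s) +
     \sum_(i < t.+1) at_prob i x (next s false) (a + dir s)) / 2.
  rewrite -big_split mulr_suml; apply: eq_bigr => i _.
  rewrite /at_prob /bump add1n averageS /=.
  by congr ((_ + _) / 2); apply: eq_average => w _; rewrite addrA.
have hI b := IH (next s b) (a + dir s).
apply: (@le_trans _ _ ((a == x)%:R + (hit_prob t x (next s true) (a + dir s) +
   hit_prob t x (next s false) (a + dir s)) / 2))%R; last first.
  by rewrite lerD2l ler_pM2r ?invr_gt0 // lerD.
rewrite /hit_prob averageS /=; case: (a == x) => /=; last by rewrite add0r.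
have: 0 <= (hit_prob t x (next s true) (a + dir s) +
   hit_prob t x (next s false) (a + dir s)) / 2.
  by rewrite divr_ge0 // addr_ge0 // average_ge0.
by rewrite /hit_prob !average_cst; lra.
Qed.

End Probabilities.
End Walk.

(** * Central binomial coefficients *)

Section CentralBinomial.
Variable R : realFieldType.

Definition cbin n : R := 'C(n.*2, n)%:R / 2 ^+ n.*2.

Lemma cbinS n : cbin n.+1 = cbin n * ((2 * n%:R + 1) / (2 * n%:R + 2)).
Proof.
have e1 : 'C(n.+1.*2, n.+1) = (2 * 'C(n.*2.+1, n.+1))%N.
  have e : 'C(n.*2.+1, n) = 'C(n.*2.+1, n.+1).
    by rewrite -[LHS]bin_sub; [congr 'C(_, _); lia|lia].
  by rewrite doubleS binS e; lia.
have e2 : (n.+1 * 'C(n.*2.+1, n.+1) = n.*2.+1 * 'C(n.*2, n))%N.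
  by rewrite -mul_bin_diag.
rewrite /cbin e1 doubleS !exprS.
have h : (2 ^+ n.*2 : R) != 0 by rewrite expf_neq0 // pnatr_eq0.
have n0 : 0 <= n%:R :> R by [].
have : (n%:R + 1) * 'C(n.*2.+1, n.+1)%:R = (2 * n%:R + 1) * 'C(n.*2, n)%:R :> R.
  have -> : 2 * n%:R + 1 = n.*2.+1%:R :> R by rewrite -[n.*2.+1%:R]natr1 -mul2n natrM.
  by rewrite natr1 -!natrM e2.
rewrite natrM.
have h1 : n%:R + 1 != 0 :> R by rewrite natr1 pnatr_eq0.
move: ('C(n.*2.+1, _)%:R : R) ('C(n.*2, _)%:R : R) => y x e3.
have -> : y = (2 * n%:R + 1) * x / (n%:R + 1) by rewrite -e3; field.
have h2 : 2 * n%:R + 2 != 0 :> R by rewrite lt0r_neq0 //; clear e1 e2; lra.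
by field; rewrite h h1 h2.
Qed.

Lemma cbin_gt0 n : 0 < cbin n.
Proof. by rewrite divr_gt0 ?exprn_gt0 // ltr0n bin_gt0; lia. Qed.

(** By [cbinS], [m * cbin m ^+ 2] is nondecreasing, because [(2m + 1)^2 >= 4m(m + 1)]; equality
    holds at [m = 1]. *)
Lemma cbin_sqr_ge n : 1 <= 4 * n.+1%:R * cbin n.+1 ^+ 2.
Proof.
elim: n => [|n IH].
  by rewrite /cbin (_ : 'C(1.*2, 1) = 2%N) // (_ : 1.*2 = 2%N) //; lra.
apply: (le_trans IH); rewrite (cbinS n.+1) -[n.+2%:R]natr1.
move: (cbin n.+1) => c; rewrite [(c * _) ^+ 2]exprMn [X in _ <= X]mulrCA [X in X <= _]mulrC.
apply: ler_wpM2l; first exact: sqr_ge0.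
have : 0 <= n.+1%:R :> R by [].
move: (n.+1%:R : R) => m m0; rewrite expr_div_n mulrA ler_pdivlMr; first by nra.
by rewrite exprn_gt0 //; lra.
Qed.

(** The left side is nonincreasing, because [(2n + 1)(2n + 3) <= (2n + 2)^2]. *)
Lemma cbin_sqr_le n : (2 * n%:R + 1) * cbin n ^+ 2 <= 1.
Proof.
elim: n => [|n IH].
  by rewrite /cbin bin0 expr0 divr1 mulr0 add0r mul1r expr1n.
apply: le_trans IH; rewrite cbinS -[n.+1%:R]natr1.
move: (cbin n) => c; rewrite [(c * _) ^+ 2]exprMn [X in X <= _]mulrCA [X in _ <= X]mulrC.
apply: ler_wpM2l; first exact: sqr_ge0.
have : 0 <= n%:R :> R by [].
move: (n%:R : R) => m m0; rewrite expr_div_n mulrA ler_pdivrMr; first by nra.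
by rewrite exprn_gt0 //; lra.
Qed.
End CentralBinomial.

(** * Recurrence of the diagonal walk *)

Section DiagonalWalk.
Variable R : archiRealFieldType.

(** Probability that the simple walk on the line started at [i] is at 0 after [n] steps. *)
Fixpoint line_prob n (i : int) : R :=
  if n is m.+1 then (line_prob m (i + 1) + line_prob m (i - 1)) / 2
  else (i == 0)%:R.

Lemma line_prob_eq0 n (i : int) : n%:Z < i -> line_prob n i = 0.
Proof.
elim: n i => [|n IH] i /= ni; first by case: eqP ni => // ->.
by rewrite !IH ?addr0 ?mul0r //; lia.
Qed.

Lemma line_prob_bin n j : line_prob n (n%:Z - (2 * j)%:Z) = 'C(n, j)%:R / 2 ^+ n.
Proof.
elim: n j => [|n IH] j /=.
  rewrite expr0 divr1 bin0n; congr (_%:R); congr nat_of_bool.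
  by case: j => //; lia.
have -> : n.+1%:Z - (2 * j)%:Z - 1 = n%:Z - (2 * j)%:Z by lia.
have h : (2 ^+ n : R) != 0 by rewrite expf_neq0 // pnatr_eq0.
rewrite IH exprS; case: j => [|j].
  by rewrite line_prob_eq0 ?bin0; [field|lia].
have -> : n.+1%:Z - (2 * j.+1)%:Z + 1 = n%:Z - (2 * j)%:Z by lia.
by rewrite IH binS natrD; field.
Qed.

Lemma line_prob_cbin n : line_prob n.*2 0 = cbin R n.
Proof. by rewrite /cbin -line_prob_bin; congr line_prob; lia. Qed.

Lemma line_prob_ge0 n i : 0 <= line_prob n i.
Proof. by elim: n i => [|n IH] i /=; rewrite ?ler0n // divr_ge0 // addr_ge0. Qed.

Definition avg4 (F : int -> int -> R) i j : R :=
  (F (i + 1) (j + 1) + F (i + 1) (j - 1) + F (i - 1) (j + 1) + F (i - 1) (j - 1)) / 4.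

(** Mean number of visits to the origin up to time [n] by the diagonal walk started at [(i, j)]; the
    product comes from the independence of the coordinates. *)
Definition green n i j : R := \sum_(m < n.+1) line_prob m i * line_prob m j.

Fixpoint hit0 n (i j : int) : R :=
  if (i == 0) && (j == 0) then 1 else
  if n is m.+1 then avg4 (hit0 m) i j else 0.

Lemma hit0S n i j : hit0 n.+1 i j = if (i == 0) && (j == 0) then 1 else avg4 (hit0 n) i j.
Proof. by []. Qed.

Lemma hit0_bounds n i j : 0 <= hit0 n i j <= 1.
Proof.
elim: n i j => [|n IH] i j; rewrite ?hit0S /=; case: ifP => _; rewrite ?lexx ?ler01 //.
have := IH (i + 1) (j + 1); have := IH (i + 1) (j - 1).
have := IH (i - 1) (j + 1); have := IH (i - 1) (j - 1); rewrite /avg4; lra.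
Qed.

Lemma greenS n i j : green n.+1 i j = ((i == 0) && (j == 0))%:R + avg4 (green n) i j.
Proof.
rewrite /green big_ord_recl /= -natrM mulnb; congr (_ + _).
rewrite /avg4 -!big_split mulr_suml; apply: eq_bigr => m _.
by rewrite /=; field.
Qed.

Lemma green_ge0 n i j : 0 <= green n i j.
Proof. by apply: sumr_ge0 => m _; rewrite mulr_ge0 ?line_prob_ge0. Qed.

Lemma greenS_ge n i j : green n i j <= green n.+1 i j.
Proof. by rewrite /green [leRHS]big_ord_recr lerDl mulr_ge0 ?line_prob_ge0. Qed.

(** Visits are counted only from the first hit on, and from then at most [green n 0 0] of them are
    expected. The induction follows the first step instead of the hitting time. *)
Lemma green_le_hit0 n i j : green n i j <= hit0 n i j * green n 0 0.
Proof.
elim: n i j => [|n IH] i j.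
  rewrite /green !big_ord1 /=.
  by case: (i == 0); case: (j == 0); rewrite /= ?mulr1 ?mul0r ?mulr0.
rewrite greenS hit0S; case: ifP => [/andP[/eqP-> /eqP->]|_].
  by rewrite mul1r greenS !eqxx.
have h k l : green n k l <= hit0 n k l * green n.+1 0 0.
  apply: (le_trans (IH k l)); apply: ler_wpM2l; last exact: greenS_ge.
  by case/andP: (hit0_bounds n k l).
have := h (i + 1) (j + 1); have := h (i + 1) (j - 1).
have := h (i - 1) (j + 1); have := h (i - 1) (j - 1).
rewrite add0r /avg4; move: (green n.+1 0 0) => g; lra.
Qed.

Lemma green_unbounded (A : R) : exists n, A <= green n 0 0.
Proof.
(* Dyadic comparison with the harmonic series: each of the [m] terms from [m] to [2m - 1] is at
   least [1 / (8m)], so doubling [m] gains [1 / 8]. *)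
pose W m := \sum_(1 <= n < m) cbin R n ^+ 2.
have dbl m : (0 < m)%N -> W m + 8^-1 <= W (2 * m)%N.
  move=> m0; rewrite /W [leRHS](big_cat_nat (n := m)) /=; [|lia|lia].
  rewrite lerD2l.
  apply: (@le_trans _ _ (\sum_(m <= n < 2 * m) (8 * m%:R)^-1)).
    rewrite sumr_const_nat (_ : 2 * m - m = m)%N; last by lia.
    rewrite -[leRHS]mulr_natr invfM divfK //.
    by rewrite pnatr_eq0; lia.
  apply: ler_sum_nat => n /andP[mn nm].
  case: n mn nm => [|n] mn nm; first by lia.
  have m1 : 0 < m%:R :> R by rewrite ltr0n.
  rewrite -div1r ler_pdivrMr; last by lra.
  apply: (le_trans (cbin_sqr_ge R n)); rewrite mulrC ler_wpM2l ?sqr_ge0 //.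
  have : n.+1%:R <= (2 * m)%:R :> R by rewrite ler_nat; lia.
  by rewrite natrM; lra.
have Wk k : k%:R / 8 <= W (2 ^ k)%N.
  elim: k => [|k IH]; first by rewrite mul0r sumr_ge0 // => n _; apply: sqr_ge0.
  have := dbl (2 ^ k)%N; rewrite expn_gt0 -expnS => /(_ isT).
  by rewrite -[k.+1%:R]natr1; lra.
have GW m : W m.+1 <= green m.*2 0 0.
  elim: m => [|m IH]; first by rewrite /W big_geq // green_ge0.
  rewrite /W big_nat_recr //= doubleS /green 2!big_ord_recr.
  rewrite -/(green m.*2 0 0) -/(W m.+1) ![nat_of_ord _]/= -doubleS line_prob_cbin.
  change (W m.+1 + cbin R m.+1 ^+ 2 <= green m.*2 0 0 +
    line_prob m.*2.+1 0 * line_prob m.*2.+1 0 + cbin R m.+1 * cbin R m.+1).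
  by rewrite expr2 lerD2r; apply: (le_trans IH); rewrite lerDl mulr_ge0 ?line_prob_ge0.
exists ((2 ^ (Num.truncn (A * 8)).+1).-1.*2); apply: le_trans (GW _).
rewrite prednK ?expn_gt0 //; apply: le_trans (Wk _).
by rewrite ler_pdivlMr // ltW // Num.Theory.truncnS_gt.
Qed.


Definition surely_hit i j := forall e : R, 0 < e -> exists n, 1 - e <= hit0 n i j.

Lemma surely_hit_next i j (a b : bool) :
  surely_hit i j -> surely_hit (i + (if a then 1 else -1)) (j + (if b then 1 else -1)).
Proof.
(* The other three neighbours count at most 1 each, so a defect [e / 4] of the mean is a defect of
   at most [e] at each neighbour. *)
have key n (e : R) : 1 - e / 4 <= avg4 (hit0 n) i j ->
    1 - e <= hit0 n (i + (if a then 1 else -1)) (j + (if b then 1 else -1)).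
  have h k l := hit0_bounds n k l.
  have := h (i + 1) (j + 1); have := h (i + 1) (j - 1).
  have := h (i - 1) (j + 1); have := h (i - 1) (j - 1).
  by rewrite /avg4; case: a; case: b; lra.
move=> ij e e0; case: (boolP ((i == 0) && (j == 0))) => [/andP[/eqP i0 /eqP j0]|ij0].
  (* At the origin [hit0] is 1 at once and tells nothing about the neighbours. The return
     probability is used instead: it is at least [1 - 1 / green n 0 0], hence at least
     [1 - e / 4]. *)
  have [n hn] := green_unbounded (4 / e).
  exists n; apply: key.
  have g0 : 0 < green n 0 0 by apply: lt_le_trans hn; rewrite divr_gt0.
  have : green n.+1 0 0 <= 1 + avg4 (hit0 n) 0 0 * green n 0 0.
    rewrite greenS !eqxx lerD2l.
    have h := green_le_hit0 n.
    have := h 1 1; have := h 1 (-1); have := h (-1) 1; have := h (-1) (-1).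
    by rewrite /avg4 !add0r; move: (green n 0 0) => g; lra.
  move: (greenS_ge n 0 0) => h1 h2.
  have : green n 0 0 - 1 <= avg4 (hit0 n) 0 0 * green n 0 0 by lra.
  rewrite -ler_pdivrMr // i0 j0; apply: le_trans.
  rewrite mulrBl mul1r divff ?gt_eqF // lerD2l lerN2.
  by rewrite -[e / 4]invf_div lef_pV2 ?posrE ?divr_gt0.
have e4 : 0 < e / 4 by rewrite divr_gt0.
have [n hn] := ij _ e4; exists n.-1.
case: n hn => [|n]; last by rewrite hit0S (negbTE ij0); exact: key.
rewrite [hit0 _ _ _]/= (negbTE ij0) => hn.
by apply: le_trans (proj1 (andP (hit0_bounds _ _ _))); lra.
Qed.

(** Steps along [(1, 1)] lead from the origin to [(p, p)], then steps along [(1, -1)] to the cell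
    wanted. *)
Lemma surely_hit_even (p q : int) : surely_hit (p + q) (p - q).
Proof.
have base : surely_hit 0 0 by move=> e e0; exists 0%N; rewrite /= ; lra.
have diag : forall p, surely_hit p p.
  elim/int_rec => [|n IH|n IH] //.
  - have := surely_hit_next true true IH.
    by rewrite /= (_ : n%:Z + 1 = n.+1%:Z) //; lia.
  - have := surely_hit_next false false IH.
    by rewrite /= (_ : - n%:Z + -1 = - n.+1%:Z) //; lia.
have := diag p; move: q; elim/int_rec => [|n IH|n IH] dp.
- by move: dp; congr surely_hit; lia.
- have := surely_hit_next true false (IH dp).
  by congr surely_hit; lia.
- have := surely_hit_next false true (IH dp).
  by congr surely_hit; lia.
Qed.

End DiagonalWalk.

(** * Averages over shifts *)

Lemma leq_bin_central m b : ('C(m.*2, b) <= 'C(m.*2, m))%N.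
Proof.
have up k : (k <= m)%N -> ('C(m.*2, m - k) <= 'C(m.*2, m))%N.
  elim: k => [|k IH] km; first by rewrite subn0.
  apply: leq_trans (IH (ltnW km)).
  have -> : (m - k)%N = (m - k.+1).+1 by lia.
  have := mul_bin_left m.*2 (m - k.+1).
  have : ((m - k.+1).+1 <= m.*2 - (m - k.+1))%N by lia.
  move: (m - k.+1)%N => j; move: 'C(_, j) 'C(_, j.+1) (_ - j)%N => x y z; nia.
case: (leqP b m) => bm.
  by have := up (m - b)%N; rewrite subKn //; apply; lia.
case: (leqP b m.*2) => bm2; last by rewrite bin_small.
have := up (b - m)%N; rewrite -bin_sub; last by lia.
by rewrite (_ : m.*2 - (m - (b - m)) = b)%N; [apply|]; lia.
Qed.

Section Decay.
Variable R : rcfType.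

(** A majorant of order [n^(-1/2)] for the atoms of the binomial law of [n] fair coins. *)
Definition decay n : R := Num.sqrt (2 / n.+1%:R).

Lemma decay_gt0 n : 0 < decay n.
Proof. by rewrite sqrtr_gt0 divr_gt0. Qed.

Lemma binom_le_decay n b : 'C(n, b)%:R / 2 ^+ n <= decay n.
Proof.
pose m := n./2.
have c0 := cbin_gt0 R m.
have : 'C(n, b)%:R / 2 ^+ n <= cbin R m.
  have e2 k : 0 < 2 ^+ k :> R by rewrite exprn_gt0.
  rewrite /cbin; case: (boolP (odd n)) => on; last first.
    rewrite (_ : n = m.*2); last by rewrite even_halfK.
    by rewrite ler_pM2r ?invr_gt0 // ler_nat leq_bin_central.
  rewrite (_ : n = m.*2.+1); last by rewrite odd_halfK //; case: (n) on.
  rewrite exprS invfM mulrA ler_pM2r ?invr_gt0 // ler_pdivrMr // -natrM ler_nat.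
  by case: b => [|b]; [rewrite bin0|rewrite binS]; have := leq_bin_central m;
     [move=> /(_ 0)%N; rewrite bin0; lia|move=> h; have := h b; have := h b.+1; lia].
move=> h; apply: (le_trans h).
apply: (@le_trans _ _ (Num.sqrt (cbin R m ^+ 2))); first by rewrite sqrtr_sqr ler_norm.
rewrite /decay ler_sqrt; last by rewrite divr_ge0.
rewrite ler_pdivlMr // mulrC.
have := cbin_sqr_le R m; have : n.+1%:R <= 2 * (2 * m%:R + 1) :> R.
  by rewrite -!natrM natr1 -natrM ler_nat /m; lia.
move: (sqr_ge0 (cbin R m)); move: (cbin R m ^+ 2) => c; nra.
Qed.

Lemma decay_lt n : decay n.+1 <= decay n.
Proof.
rewrite /decay ler_sqrt ?divr_ge0 // ler_pM2l // lef_pV2 ?posrE ?ltr0n // ler_nat; lia.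
Qed.

(** A telescoping majorant for the cubes. For consecutive values [x], [y] one has
    [2(x^2 - y^2) = x^2 y^2], and [x + y <= 2x]. *)
Lemma decay_diff n : decay n.+1 ^+ 3 <= 4 * (decay n - decay n.+1).
Proof.
have := decay_lt n; have := decay_gt0 n; have := decay_gt0 n.+1.
have : 2 * (decay n ^+ 2 - decay n.+1 ^+ 2) = decay n ^+ 2 * decay n.+1 ^+ 2.
  rewrite !sqr_sqrtr ?divr_ge0 //.
  have n1 : n.+1%:R != 0 :> R by rewrite pnatr_eq0.
  have n2 : n.+2%:R != 0 :> R by rewrite pnatr_eq0.
  rewrite -[n.+2%:R]natr1 in n2 *; move: (n.+1%:R : R) n1 n2 => m n1 n2.
  by field; rewrite n1 n2.
move: (decay n) (decay n.+1) => x y e y0 x0 yx.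
have : x * y ^+ 2 <= 4 * (x - y).
  have := sqr_ge0 (x - y); rewrite -(ler_pM2r x0); nra.
have := mulr_ge0 (ltW y0) (ltW y0); nra.
Qed.

Section Shift.
Variable V : zmodType.
Implicit Types (D a x : V) (F : V -> R).

Definition shift_avg D F a : R := (F a + F (a + D)) / 2.

Lemma iter_shift_avg D F n a :
  iter n (shift_avg D) F a = \sum_(b < n.+1) 'C(n, b)%:R / 2 ^+ n * F (a + D *+ b).
Proof.
elim: n a => [|n IH] a; first by rewrite big_ord1 /= expr0 divr1 mul1r mulr0n addr0.
rewrite iterS {1}/shift_avg !IH.
have -> : \sum_(b < n.+1) 'C(n, b)%:R / 2 ^+ n * F (a + D + D *+ b) =
    \sum_(b < n.+1) 'C(n, b)%:R / 2 ^+ n * F (a + D *+ b.+1).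
  by apply: eq_bigr => b _; rewrite -addrA -mulrS.
have h : (2 ^+ n : R) != 0 by rewrite expf_neq0 // pnatr_eq0.
rewrite big_ord_recl [X in (_ + X) / 2]big_ord_recr /=.
rewrite [RHS]big_ord_recl [X in _ = _ + X]big_ord_recr /=.
rewrite !bin0 !binn mulr0n addr0 -addrA [X in (_ + X) / 2]addrA -big_split /=.
rewrite mulrDl (mulrDl (\sum_(i < n) _)) exprS.
congr (_ + (_ + _)); [by field| |by field].
rewrite mulr_suml; apply: eq_bigr => i _; rewrite /bump add1n binS natrD.
by field.
Qed.

Lemma shift_avgC D1 D2 F : shift_avg D1 (shift_avg D2 F) = shift_avg D2 (shift_avg D1 F).
Proof. by apply/funext => a; rewrite /shift_avg (addrAC a D1); field. Qed.

Definition shift_avg3 D1 D2 D3 F := shift_avg D1 (shift_avg D2 (shift_avg D3 F)).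

Lemma iter_shift_avgC D1 D2 F n :
  iter n (shift_avg D1) (shift_avg D2 F) = shift_avg D2 (iter n (shift_avg D1) F).
Proof. by elim: n => //= n ->; rewrite shift_avgC. Qed.

Lemma iter_shift_avg3 D1 D2 D3 F n :
  iter n (shift_avg3 D1 D2 D3) F =
  iter n (shift_avg D1) (iter n (shift_avg D2) (iter n (shift_avg D3) F)).
Proof.
elim: n => //= n ->; rewrite /shift_avg3; congr (shift_avg D1 _).
by rewrite !iter_shift_avgC.
Qed.

(** By independence at most one triple of shift counts leads from [a] to [x], and its weight is a
    product of three binomial probabilities. *)
Lemma iter_shift_avg3_indicator D1 D2 D3 x n a :
  (forall i j k i' j' k' : nat,
     D1 *+ i + D2 *+ j + D3 *+ k = D1 *+ i' + D2 *+ j' + D3 *+ k' ->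
     [/\ i = i', j = j' & k = k']) ->
  iter n (shift_avg3 D1 D2 D3) (fun b => (b == x)%:R) a <= decay n ^+ 3.
Proof.
move=> indep; rewrite iter_shift_avg3 iter_shift_avg.
pose c (i : 'I_n.+1) : R := 'C(n, i)%:R / 2 ^+ n.
have c0 i : 0 <= c i by rewrite divr_ge0 ?exprn_ge0.
have cd i : c i <= decay n by exact: binom_le_decay.
have -> : \sum_(i < n.+1) 'C(n, i)%:R / 2 ^+ n *
    iter n (shift_avg D2) (iter n (shift_avg D3) (fun b => (b == x)%:R)) (a + D1 *+ i) =
  \sum_(p : 'I_n.+1 * ('I_n.+1 * 'I_n.+1)) c p.1 * (c p.2.1 * c p.2.2) *
     (a + D1 *+ p.1 + D2 *+ p.2.1 + D3 *+ p.2.2 == x)%:R.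
  rewrite -(pair_bigA _ (fun i p => c i * (c p.1 * c p.2) *
     (a + D1 *+ i + D2 *+ p.1 + D3 *+ p.2 == x)%:R)); apply: eq_bigr => i _.
  rewrite -(pair_bigA _ (fun j k => c i * (c j * c k) *
     (a + D1 *+ i + D2 *+ j + D3 *+ k == x)%:R)) iter_shift_avg mulr_sumr.
  apply: eq_bigr => j _; rewrite iter_shift_avg !mulr_sumr.
  by apply: eq_bigr => k _; rewrite /c !mulrA.
pose good (p : 'I_n.+1 * ('I_n.+1 * 'I_n.+1)) :=
  a + D1 *+ p.1 + D2 *+ p.2.1 + D3 *+ p.2.2 == x.
case: (pickP good) => [p gp|bad]; last first.
  by rewrite big1 ?exprn_ge0 ?ltW ?decay_gt0 // => p _; rewrite [_ == _]bad mulr0.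
rewrite (bigD1 p) //= big1 ?addr0 => [|p' p'p].
  rewrite [_ == _]gp mulr1 exprS expr2.
  have c2 : 0 <= c p.2.1 * c p.2.2 by apply: mulr_ge0.
  by apply: ler_pM => //; apply: ler_pM.
case: (boolP (good p')) => [gp'|/negbTE]; last by rewrite /good => ->; rewrite mulr0.
case/eqP: p'p; have := etrans (eqP gp') (esym (eqP gp)).
rewrite -!addrA => /addrI; rewrite !addrA => /indep[].
by case: p p' {gp gp'} => [i [j k]] [i' [j' k']] /= /val_inj -> /val_inj -> /val_inj ->.
Qed.

End Shift.
End Decay.

(** * Expected decay along switches *)

Section Supersolution.
Variables (R : archiRcfType) (S : finType) (next : S -> bool -> S) (q : S).
Variables (L : nat) (sw : seq (seq bool)).
Let en := endstate next.
Hypothesis sw_size : forall w, w \in sw -> size w = L.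
Hypothesis sw_loop : forall w, w \in sw -> en q w = q.
Hypothesis sw_neq0 : sw != [::].
Hypothesis q_recurrent :
  forall w, (L %| size w)%N -> exists2 v, (L %| size v)%N & en (en q w) v = q.

Definition switch s w := (s == q) && (w \in sw).

(* Over [N] blocks from state [s], the mean of [decay ^+ 3] at [n] plus the
   number of switches. *)
Fixpoint switch_decay N s n : R :=
  if N is N'.+1 then
    average L (fun w => switch_decay N' (en s w) (n + switch s w)%N)
  else decay R n ^+ 3.

Let reached s := exists2 w, (L %| size w)%N & s = en q w.

Let reachq m s := has (fun w => en s w == q) (words (m * L)).

Lemma reachqP m s : reflect (exists2 w, size w = (m * L)%N & en s w = q) (reachq m s).
Proof.
apply: (iffP hasP) => [[w]|[w sw' e]].
  by rewrite mem_words => /eqP sw' /eqP e; exists w.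
by exists w; rewrite ?mem_words ?e //; exact/eqP.
Qed.

(** Least number of blocks leading from [s] to [q]; the default 0 does not occur for reached
    states. *)
Let dist s := if pselect (exists m, reachq m s) is left h then ex_minn h else 0%N.

Lemma distP s : (exists m, reachq m s) ->
  reachq (dist s) s /\ forall m, reachq m s -> (dist s <= m)%N.
Proof.
rewrite /dist => h; case: pselect => // h'.
by case: ex_minnP => m; split.
Qed.

(* [tau] is a supersolution of the equation satisfied by the mean number of
   blocks before the next switch; its only input is that from distance [m] to
   [q] some block leads to distance at most [m - 1]. *)
Let far := \max_s dist s.
Let eta : R := (2 * 2 ^+ L)^-1.
Let top : R := eta ^- far.+1.
Let tau s := top - top * eta ^+ (dist s).+1.

Lemma reached_reachq s : reached s -> exists m, reachq m s.
Proof.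
move=> [w Lw ->]; have [v /dvdnP[m sv] e] := q_recurrent Lw.
by exists m; apply/reachqP; exists v.
Qed.

Lemma eta_gt0 : 0 < eta.
Proof. by rewrite invr_gt0 mulr_gt0 ?exprn_gt0. Qed.

Lemma eta_le1 : eta <= 1.
Proof. by rewrite invf_le1 ?mulr_gt0 ?exprn_gt0 //; have := exprn_ege1 L (ler1n R 2); lra. Qed.

Lemma top_gt0 : 0 < top.
Proof. by rewrite invr_gt0 exprn_gt0 ?eta_gt0. Qed.

Lemma top_eta k : top * eta ^+ k <= top.
Proof.
rewrite -[leRHS]mulr1 ler_pM2l ?top_gt0 //.
by apply: exprn_ile1; [exact: ltW eta_gt0|exact: eta_le1].
Qed.

Lemma tau_ge0 s : 0 <= tau s.
Proof. by rewrite subr_ge0 top_eta. Qed.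

Lemma tau_le_top s : tau s <= top.
Proof. by rewrite gerBl mulr_ge0 ?exprn_ge0 // ltW ?top_gt0 ?eta_gt0. Qed.

(** One good block, of probability [2 ^- L = 2 * eta], brings the mean down from [top] by
    [2 * top * eta ^+ (dist s).+1]. Half of this is the deficit of [tau s]; the other half is at
    least 1 by the choice of [top]. *)
Lemma tau_super s : reached s ->
  1 + average L (fun w => if switch s w then 0 else tau (en s w)) <= tau s.
Proof.
move=> rs; have [rd dmin] := distP (reached_reachq rs).
have gap : average L (fun w => if switch s w then 0 else tau (en s w)) <=
    top - top * eta ^+ (dist s) / 2 ^+ L.
  have le w : size w = L -> (if switch s w then 0 else tau (en s w)) <= top.
    by case: ifP => _ _; [apply: ltW top_gt0|exact: tau_le_top].
  have [w wL gw] : exists2 w, size w = L &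
      (if switch s w then 0 else tau (en s w)) <= top - top * eta ^+ dist s.
    (* The good block is a switch word at distance 0, where the value 0 equals
       [top - top * eta ^+ 0], and otherwise the first block of a shortest word to [q]. *)
    have /reachqP[w ws e] := rd; case ds : (dist s) ws => [|m] ws.
      have [u usw] : exists u, u \in sw.
        by case: (sw) sw_neq0 => // u l _; exists u; rewrite mem_head.
      exists u; first exact: sw_size.
      have -> : switch s u by rewrite /switch usw -e (size0nil ws) eqxx.
      by rewrite expr0 mulr1 subrr.
    exists (take L w); first by rewrite size_take_min ws; lia.
    case: ifP => _; first by rewrite subr_ge0 top_eta.
    have : reachq m (en s (take L w)).
      apply/reachqP; exists (drop L w); first by rewrite size_drop ws; lia.
      by rewrite /en -endstate_cat cat_take_drop.
    move=> rm; have [_ /(_ _ rm) dm] := distP (ex_intro _ m rm).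
    rewrite lerD2l lerN2 ler_pM2l ?top_gt0 //.
    by apply: ler_wiXn2l; rewrite ?ltnS // ?eta_le1 // ltW ?eta_gt0.
  exact: average_le_gap wL le gw.
have one : 1 <= top * eta ^+ (dist s).+1.
  rewrite -[leLHS](mulVf (x := eta ^+ far.+1)) ?expf_neq0 ?gt_eqF ?eta_gt0 //.
  rewrite ler_pM2l ?top_gt0 //; apply: ler_wiXn2l; rewrite ?eta_le1 // ?ltW ?eta_gt0 //.
  by rewrite ltnS; apply: leq_bigmax.
have half : (2 ^+ L)^-1 = 2 * eta by rewrite /eta invfM mulrA divff ?mul1r ?pnatr_eq0.
move: gap one; rewrite half /tau exprS; move: (average _ _) => a.
have -> : top * eta ^+ dist s * (2 * eta) = 2 * (top * (eta * eta ^+ dist s)) by ring.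
by move: (top * (eta * _)) => t; lra.
Qed.

(** The first term pays for the blocks up to the next switch, the second for all later ones: at a
    switch, [decay_diff] and [tau <= top] let the drop of the second term pay for the new first
    term. *)
Lemma switch_decay_super N s n : reached s ->
  \sum_(i < N) switch_decay i s n <= tau s * decay R n ^+ 3 + 4 * top * decay R n.
Proof.
elim: N s n => [|N IH] s n rs.
  rewrite big_ord0 addr_ge0 // mulr_ge0 ?tau_ge0 ?exprn_ge0 ?ltW ?decay_gt0 //.
  by rewrite mulr_gt0 ?top_gt0.
rewrite big_ord_recl /=.
have rn w : size w = L -> reached (en s w).
  move=> wL; case: rs => u Lu ->; exists (u ++ w); rewrite ?size_cat ?wL ?dvdn_addl //.
  by rewrite /en endstate_cat.
apply: (@le_trans _ _ (decay R n ^+ 3 + average L (fun w =>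
    decay R n ^+ 3 * (if switch s w then 0 else tau (en s w)) + 4 * top * decay R n))).
  rewrite lerD2l -average_sum; apply: le_average => w wL.
  apply: (le_trans (IH _ _ (rn w wL))).
  case: (switch s w); last by rewrite /= addn0 mulrC.
  rewrite /= addn1 mulr0 add0r.
  have := decay_diff R n; have := tau_le_top (en s w); have := tau_ge0 (en s w).
  have : 0 <= decay R n.+1 ^+ 3 by rewrite exprn_ge0 // ltW ?decay_gt0.
  have := top_gt0.
  move: (tau _) (decay R n) (decay R n.+1) => t x y; move: (y ^+ 3) => y3; nra.
rewrite averageD average_cst averageZ.
have := tau_super rs; have : 0 <= decay R n ^+ 3 by rewrite exprn_ge0 // ltW ?decay_gt0.
by move: (decay R n ^+ 3) (average _ _) (tau s) => x a t; nra.
Qed.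

Lemma switch_decay_ge0 N s n : 0 <= switch_decay N s n.
Proof.
elim: N s n => [|N IH] s n /=; first by rewrite exprn_ge0 // ltW ?decay_gt0.
by apply: average_ge0.
Qed.

(** The partial sums are bounded; if every tail could exceed [e], they could be raised by [e] again
    and again. *)
Lemma switch_decay_tail (e : R) : 0 < e -> exists K, forall M,
  \sum_(K <= i < M) switch_decay i q 0 <= e.
Proof.
move=> e0; apply: contrapT => /forallNP H.
pose W m := \sum_(0 <= i < m) switch_decay i q 0.
have bnd m : W m <= top * decay R 0 ^+ 3 + 4 * top * decay R 0.
  rewrite /W big_mkord; apply: (le_trans (switch_decay_super _ _ _)).
    by exists [::].
  by rewrite lerD2r ler_wpM2r ?tau_le_top // exprn_ge0 // ltW ?decay_gt0.
have step m : exists m', W m + e <= W m'.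
  have /existsNP[M /negP] := H m; rewrite -ltNge => hM; exists M.
  case: (leqP m M) => mM; last by move: hM; rewrite big_geq ?(ltnW mM) // ltNge ltW.
  by rewrite /W (big_cat_nat (n := m) (p := M)) //= lerD2l ltW.
have many k : exists m, k%:R * e <= W m.
  elim: k => [|k [m hm]]; first by exists 0%N; rewrite mul0r /W big_geq.
  have [m' hm'] := step m; exists m'; apply: le_trans hm'.
  by rewrite -[k.+1%:R]natr1 mulrDl mul1r lerD2r.
move: bnd; set b := (X in forall m, _ <= X) => bnd.
have [m hm] := many (Num.truncn (b / e)).+1.
have := le_trans hm (bnd m).
by rewrite leNgt -ltr_pdivrMr // truncnS_gt.
Qed.
End Supersolution.

(** * Walks with independent switches *)

Section BlockOperator.
Variables (R : rcfType) (S : finType) (next : S -> bool -> S).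
Variables (V : zmodType) (dir : S -> V) (L : nat).
Let en := endstate next.
Let dp := disp next dir.
Implicit Types (F G : S -> V -> R).

Definition block_avg F s a : R := average L (fun w => F (en s w) (a + dp s w)).

(** Displacements do not depend on the current cell, so the coin of a switch may be tossed after all
    later blocks. *)
Lemma block_avg_shift D F :
  block_avg (fun s => shift_avg D (F s)) = fun s => shift_avg D (block_avg F s).
Proof.
apply/funext => s; apply/funext => a; rewrite /block_avg /shift_avg -averageD.
rewrite [RHS]mulrC -averageZ; apply: eq_average => w _.
by rewrite (addrAC a D) mulrC.
Qed.

Lemma iter_block_avg_shift3 D1 D2 D3 N F :
  iter N block_avg (fun s => shift_avg3 D1 D2 D3 (F s)) =
  fun s => shift_avg3 D1 D2 D3 (iter N block_avg F s).
Proof. by elim: N => //= N ->; rewrite /shift_avg3 !block_avg_shift. Qed.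

Lemma le_iter_block_avg N F G s a : (forall s a, F s a <= G s a) ->
  iter N block_avg F s a <= iter N block_avg G s a.
Proof.
move=> FG; elim: N s a => [|N IH] s a //=.
by apply: le_average => w _; apply: IH.
Qed.

Lemma iter_block_avg_sum N I (r : seq I) (F : I -> S -> V -> R) s a :
  iter N block_avg (fun s a => \sum_(i <- r) F i s a) s a =
  \sum_(i <- r) iter N block_avg (F i) s a.
Proof.
elim: N s a => [|N IH] s a //=.
by rewrite /block_avg -average_sum; apply: eq_average => w _; rewrite IH.
Qed.

Lemma at_prob_block N j x s a :
  at_prob next dir R (N * L + j) x s a =
  iter N block_avg (at_prob next dir R j x) s a.
Proof.
elim: N s a => [|N IH] s a //=.
rewrite mulSn -addnA /at_prob average_cat; apply: eq_average => w _.
by rewrite -IH; apply: eq_average => v _; rewrite disp_cat addrA.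
Qed.

(** A crude bound for the incomplete last block: the cell [b] must be [x] minus the displacement of
    some word of length [j] read from some state. *)
Lemma at_prob_le_indicators j x s b :
  at_prob next dir R j x s b <=
  \sum_(y <- [seq x - dp t w | t <- enum S, w <- words j]) (b == y)%:R.
Proof.
set Y := (X in _ <= \sum_(y <- X) _).
rewrite -[leRHS](average_cst j); apply: le_average => w wj.
case: eqP => [e|_]; last by apply: sumr_ge0 => y _; apply: ler0n.
have bY : b \in Y.
  apply/allpairsP; exists (s, w); rewrite mem_enum mem_words wj eqxx /= -e.
  by rewrite addrK.
rewrite (perm_big (b :: rem b Y)) ?big_cons ?eqxx ?lerDl ?sumr_ge0 //.
exact: perm_to_rem.
Qed.

End BlockOperator.

Section Switching.
Variables (R : archiRcfType) (S : finType) (next : S -> bool -> S).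
Variables (V : zmodType) (dir : S -> V) (q : S).
Let en := endstate next.
Let dp := disp next dir.
Variables (u1 v1 u2 v2 u3 v3 : seq bool).
Let D1 := dp q v1 - dp q u1.
Let D2 := dp q v2 - dp q u2.
Let D3 := dp q v3 - dp q u3.
Hypotheses (s1 : size u1 = size v1) (s2 : size u2 = size v2) (s3 : size u3 = size v3).
Hypotheses (lu1 : en q u1 = q) (lv1 : en q v1 = q) (lu2 : en q u2 = q)
  (lv2 : en q v2 = q) (lu3 : en q u3 = q) (lv3 : en q v3 = q).
Hypothesis indep : forall i j k i' j' k' : nat,
  D1 *+ i + D2 *+ j + D3 *+ k = D1 *+ i' + D2 *+ j' + D3 *+ k' ->
  [/\ i = i', j = j' & k = k'].
Hypothesis q_return : forall w, exists v, en (en q w) v = q.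

Let L := (size u1 + size u2 + size u3)%N.
Let sw := [seq x ++ y | x <- [:: u1; v1],
                        y <- [seq x ++ y | x <- [:: u2; v2], y <- [:: u3; v3]]].

Lemma switch_words_size w : w \in sw -> size w = L.
Proof.
by rewrite !inE => /or4P[|||/or4P[|||/orP[]]] /eqP->;
  rewrite !size_cat /L -?s1 -?s2 -?s3 addnA.
Qed.

Lemma switch_words_loop w : w \in sw -> en q w = q.
Proof.
by rewrite !inE => /or4P[|||/or4P[|||/orP[]]] /eqP->;
  rewrite /en !endstate_cat -/en ?lu1 ?lv1 ?lu2 ?lv2 ?lu3 ?lv3.
Qed.

Lemma switch_words_neq : [/\ u1 != v1, u2 != v2 & u3 != v3].
Proof.
split; apply/eqP => e.
- have [] := @indep 1 0 0 0 0 0; last by [].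
  by rewrite /D1 e subrr !mulr0n mul0rn.
- have [] := @indep 0 1 0 0 0 0; last by [].
  by rewrite /D2 e subrr !mulr0n mul0rn.
- have [] := @indep 0 0 1 0 0 0; last by [].
  by rewrite /D3 e subrr !mulr0n mul0rn.
Qed.

Lemma switch_words_uniq : uniq sw.
Proof.
have [/negbTE n1 /negbTE n2 /negbTE n3] := switch_words_neq.
have n1' := n1; have n2' := n2; have n3' := n3.
rewrite eq_sym in n1'; rewrite eq_sym in n2'; rewrite eq_sym in n3'.
rewrite /= !inE !eqseq_cat ?s1 ?s2 ?s3 //.
by rewrite ?n1 ?n2 ?n3 ?n1' ?n2' ?n3' ?eqxx.
Qed.

Lemma block_size_gt0 : (0 < L)%N.
Proof.
have [n1 _ _] := switch_words_neq; rewrite /L; move: s1 n1.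
by case: (u1) => [|? ?]; case: (v1).
Qed.

Lemma q_return_block w : (L %| size w)%N ->
  exists2 v, (L %| size v)%N & en (en q w) v = q.
Proof.
move=> Lw; have [v e] := q_return w.
have eloop m : en q (iter m (cat (w ++ v)) [::]) = q.
  by elim: m => // m IH; rewrite iterS /en !endstate_cat -/en e.
exists (v ++ iter L.-1 (cat (w ++ v)) [::]); last by rewrite /en endstate_cat -/en e eloop.
(* [v (w v)^(L-1)] has length [L (|w| + |v|) - |w|]. *)
have sloop m : size (iter m (cat (w ++ v)) [::]) = (m * (size w + size v))%N.
  by elim: m => // m IH; rewrite iterS !size_cat IH.
rewrite size_cat sloop.
have -> : (size v + L.-1 * (size w + size v) = L * size v + L.-1 * size w)%N.
  by have := block_size_gt0; move: L => [//|l] _; rewrite -pred_Sn; lia.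
by apply: dvdn_add; [exact: dvdn_mulr|exact: dvdn_mull].
Qed.

Let inc_decay N s n := switch_decay R next q L sw N s n.
Let T := block_avg (R := R) next dir L.

(** The indicator of [x] averaged over the postponed shifts of [n] switches. *)
Let point n x (s : S) := iter n (shift_avg3 D1 D2 D3) (fun b => (b == x)%:R) : V -> R.

(** In state [q] the eight switch words merge into one [shift_avg3], which commutes with the
    remaining blocks and turns [point n x] into [point n.+1 x]. Once no block remains,
    [iter_shift_avg3_indicator] applies. *)
Lemma point_le_switch_decay N n x s a :
  iter N T (point n x) s a <= inc_decay N s n.
Proof.
elim: N n s a => [|N IH] n s a /=; first exact: iter_shift_avg3_indicator.
case: (eqVneq s q) => [->|sq]; last first.
  apply: le_average => w wL; apply: le_trans (IH _ _ _) _.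
  by rewrite /switch (negbTE sq) /= addn0.
rewrite /T /block_avg /average ler_pM2r ?invr_gt0 ?exprn_gt0 //.
have split (F : seq bool -> R) : \sum_(w <- words L) F w =
    \sum_(w <- sw) F w + \sum_(w <- words L | w \notin sw) F w.
  rewrite (bigID (mem sw)) /= -big_filter; congr (_ + _); apply: perm_big.
  apply: uniq_perm; rewrite ?filter_uniq ?uniq_words ?switch_words_uniq // => w.
  rewrite mem_filter mem_words; case: (boolP (w \in sw)) => //= /switch_words_size ->.
  exact: eqxx.
rewrite split [leRHS]split; apply: lerD; last first.
  apply: ler_sum => w wsw; apply: le_trans (IH _ _ _) _.
  by rewrite /switch (negbTE wsw) andbF addn0.
have -> : \sum_(w <- sw) switch_decay R next q L sw N (endstate next q w)
    (n + switch q sw q w) = 8 * inc_decay N q n.+1.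
  transitivity (\sum_(w <- sw) inc_decay N q n.+1); last first.
    by rewrite /= !big_cons big_nil; ring.
  apply: eq_big_seq => w wsw; rewrite -/(en q w) switch_words_loop //.
  by rewrite /switch wsw eqxx addn1.
pose p1 := dp q u1; pose p2 := dp q u2; pose p3 := dp q u3.
have -> : \sum_(w <- sw) iter N (block_avg next dir L) (point n x) (endstate next q w)
    (a + disp next dir q w) =
    8 * iter N T (point n.+1 x) q (a + (p1 + p2 + p3)).
  transitivity (\sum_(w <- sw) iter N T (point n x) q (a + dp q w)).
    by apply: eq_big_seq => w wsw; rewrite -/(en q w) switch_words_loop.
  have -> : point n.+1 x = fun s => shift_avg3 D1 D2 D3 (point n x s) by [].
  rewrite iter_block_avg_shift3 /shift_avg3 /shift_avg.
  move: (iter N _ _ q) => G.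
  (* The shift [t_i] relative to [p_i] is 0 for [u_i] and [D_i] for [v_i]. *)
  have E x1 x2 x3 t1 t2 t3 : en q x1 = q -> en q x2 = q -> dp q x1 = p1 + t1 ->
      dp q x2 = p2 + t2 -> dp q x3 = p3 + t3 ->
      a + dp q (x1 ++ (x2 ++ x3)) = a + (p1 + p2 + p3) + t1 + t2 + t3.
    move=> e1 e2 d1 d2 d3; rewrite /dp !disp_cat -/dp -/en e1 e2 d1 d2 d3.
    by rewrite !addrA (addrAC _ t1 p2) (addrAC _ t2 p3) (addrAC _ t1 p3).
  have dv1 : dp q v1 = p1 + D1 by rewrite [RHS]addrC subrK.
  have dv2 : dp q v2 = p2 + D2 by rewrite [RHS]addrC subrK.
  have dv3 : dp q v3 = p3 + D3 by rewrite [RHS]addrC subrK.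
  have du1 : dp q u1 = p1 + 0 by rewrite addr0.
  have du2 : dp q u2 = p2 + 0 by rewrite addr0.
  have du3 : dp q u3 = p3 + 0 by rewrite addr0.
  rewrite /= !big_cons big_nil.
  rewrite (E _ _ _ _ _ _ lu1 lu2 du1 du2 du3) (E _ _ _ _ _ _ lu1 lu2 du1 du2 dv3).
  rewrite (E _ _ _ _ _ _ lu1 lv2 du1 dv2 du3) (E _ _ _ _ _ _ lu1 lv2 du1 dv2 dv3).
  rewrite (E _ _ _ _ _ _ lv1 lu2 dv1 du2 du3) (E _ _ _ _ _ _ lv1 lu2 dv1 du2 dv3).
  rewrite (E _ _ _ _ _ _ lv1 lv2 dv1 dv2 du3) (E _ _ _ _ _ _ lv1 lv2 dv1 dv2 dv3).
  by rewrite !addr0; field.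
by rewrite ler_pM2l.
Qed.

(** In the union bound over times, the first blocks vanish because [x] is too far, and the others
    are bounded by a tail of a convergent series that does not depend on [x]. *)
Lemma hit_prob_far_le (e : R) : 0 < e -> exists K, forall x a,
  (forall w, (size w < K)%N -> a + dp q w != x) ->
  forall M, hit_prob next dir R M x q a <= e.
Proof.
move=> e0.
(* A block contains [L] times, and each costs at most [#|S| * 2 ^ L] indicators. *)
pose c := (L * (#|S| * 2 ^ L))%N.
have c0 : (0 < c)%N.
  rewrite !muln_gt0 block_size_gt0 expn_gt0 /=; apply/andP; split => //.
  by apply/card_gt0P; exists q.
have e'0 : 0 < e / c%:R by rewrite divr_gt0 ?ltr0n.
have [K hK] := switch_decay_tail switch_words_size
  (isT : sw != [::]) q_return_block e'0.
exists (K * L)%N => x a far M; apply: (le_trans (hit_prob_le_green _ _ _ _ _ _ _)).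
have at0 t s b : 0 <= at_prob next dir R t x s b.
  by apply: average_ge0 => w; apply: ler0n.
apply: (@le_trans _ _ (\sum_(0 <= t < M.+1 * L) at_prob next dir R t x q a)).
  rewrite -(big_mkord xpredT (fun t => at_prob next dir R t x q a)).
  rewrite [leRHS](big_cat_nat (n := M.+1)) //=; last by rewrite leq_pmulr // block_size_gt0.
  by rewrite lerDl sumr_ge0.
rewrite big_nat_mul.
apply: (@le_trans _ _ (\sum_(0 <= N < M.+1 | (K <= N)%N) c%:R * inc_decay N q 0)).
  rewrite [leRHS]big_mkcond; apply: ler_sum => N _.
  case: (leqP K N) => KN; last first.
    rewrite big_nat_cond big1 // => t /andP[/andP[_ tN] _].
    rewrite /at_prob -(average_cst t 0); apply: eq_average => w wt.
    case: eqP (far w) => // _; rewrite wt => /(_ _)/negP; case=> //.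
    by apply: leq_trans tN _; rewrite leq_mul2r KN orbT.
  apply: (@le_trans _ _ (\sum_(N * L <= t < N.+1 * L) (#|S| * 2 ^ L)%:R * inc_decay N q 0)).
    apply: ler_sum_nat => t /andP[Nt tN].
    have -> : t = (N * L + (t - N * L))%N by lia.
    have jL : (t - N * L < L)%N by lia.
    move: (t - N * L)%N jL => j jL; rewrite at_prob_block.
    pose Y := [seq x - dp t w | t <- enum S, w <- words j].
    apply: (@le_trans _ _ (iter N T (fun _ b => \sum_(y <- Y) (b == y)%:R) q a)).
      by apply: le_iter_block_avg => t' b; exact: at_prob_le_indicators.
    rewrite iter_block_avg_sum.
    apply: (@le_trans _ _ (\sum_(y <- Y) inc_decay N q 0)).
      by apply: ler_sum => y _; exact: (point_le_switch_decay N 0 y).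
    rewrite big_const_seq count_predT iter_addr_0 -[leLHS]mulr_natl.
    apply: ler_wpM2r; first exact: switch_decay_ge0.
    rewrite ler_nat size_allpairs size_words -cardE leq_mul2l leq_exp2l //.
    by rewrite ltnW // orbT.
  rewrite sumr_const_nat mulSn addnK -[leLHS]mulr_natl mulrA -natrM; exact: lexx.
rewrite -mulr_sumr mulrC -ler_pdivlMr ?ltr0n //.
by have := hK M.+1; rewrite (big_nat_widenl _ 0).
Qed.

End Switching.

(** * Recurrent states and independent loops *)

(** Among the reachable states, take one whose set of reachable states is smallest: moving on cannot
    shrink this set, so the state stays reachable. *)
Lemma exists_recurrent_state (S : finType) (next : S -> bool -> S) q0 :
  exists w0, forall w, exists v,
    endstate next (endstate next (endstate next q0 w0) w) v = endstate next q0 w0.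
Proof.
pose reach s := [set t | `[<exists w, endstate next s w = t>]].
have reachP s t : reflect (exists w, endstate next s w = t) (t \in reach s).
  by rewrite inE; exact: asboolP.
have r0 : q0 \in reach q0 by apply/reachP; exists [::].
case: (@arg_minnP _ q0 (mem (reach q0)) (fun s => #|reach s|) r0) => q /reachP[w0 e] qmin.
exists w0 => w; rewrite e.
set s := endstate next q w.
have sub : reach s \subset reach q.
  apply/fintype.subsetP => t /reachP[v <-]; apply/reachP; exists (w ++ v).
  by rewrite endstate_cat.
have sq0 : s \in reach q0 by apply/reachP; exists (w0 ++ w); rewrite endstate_cat e.
have /eqP eqr : reach s == reach q by rewrite eqEcard sub qmin.
by apply/reachP; rewrite eqr; apply/reachP; exists [::].
Qed.

(** Greedy choice: while there are fewer than [k] rows, a nonzero column of the cokernel kills them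
    all, and a vector on which it does not vanish can be added. *)
Lemma exists_independent_rows (R : realFieldType) k (P : 'rV[int]_k -> Prop) :
  (forall phi : 'cV[R]_k, phi != 0 ->
     exists2 v, P v & map_mx intr v *m phi != 0) ->
  forall m, (m <= k)%N -> exists2 A : 'M[int]_(m, k),
    (forall i, P (row i A)) & row_free (map_mx intr A : 'M[R]_(m, k)).
Proof.
move=> hP; elim=> [|m IH] mk.
  by exists 0; [case|apply: inj_row_free => v _; apply/rowP; case].
have [A PA freeA] := IH (ltnW mk).
pose AR : 'M[R]_(m, k) := map_mx intr A.
have : cokermx AR != 0.
  by rewrite -mxrank_eq0 mxrank_coker (eqP freeA) subn_eq0 -ltnNge.
move=> cok; have [j phi0] : exists j, col j (cokermx AR) != 0.
  apply: contrapT => /forallNP h; move/eqP: cok; apply; apply/matrixP => i j.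
  by have /negP/negPn/eqP/colP/(_ i) := h j; rewrite !mxE.
have Aphi : AR *m col j (cokermx AR) = 0 by rewrite colE mulmxA mulmx_coker mul0mx.
move: (col j _) phi0 Aphi => phi phi0 Aphi.
have [v Pv vphi] := hP _ phi0.
exists (col_mx v A : 'M[int]_(1 + m, k)).
  move=> i; case: (@split_ordP 1 m i) => l ->.
    by rewrite (rowKu l v A) (_ : row l v = v) // ord1; apply/rowP => ?; rewrite mxE.
  by rewrite (rowKd l v A); apply: PA.
have gen : row_free (map_mx intr (col_mx v A) : 'M[R]_(1 + m, k)); last exact: gen.
rewrite map_col_mx; apply: inj_row_free => u.
rewrite -[u]hsubmxK mul_row_col; move: (lsubmx u) (rsubmx u) => a b ab.
have a0 : a = 0.
  have := congr1 (mulmx^~ phi) ab.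
  rewrite mulmxDl -!mulmxA -/AR Aphi mulmx0 addr0 mul0mx.
  rewrite [map_mx intr v *m phi]mx11_scalar mul_mx_scalar => /eqP.
  rewrite scaler_eq0 => /orP[/eqP e|/eqP //].
  by move: vphi; rewrite [map_mx intr v *m phi]mx11_scalar e raddf0 eqxx.
move: ab; rewrite a0 mul0mx add0r -/AR => bA.
have -> : b = 0.
  by apply: (row_free_inj freeA); rewrite bA mul0mx.
by rewrite row_mx0.
Qed.

Lemma row_free3_nat (R : realFieldType) (A : 'M[int]_3) i j k i' j' k' :
  row_free (map_mx intr A : 'M[R]_3) ->
  row 0 A *+ i + row 1 A *+ j + row 2 A *+ k =
  row 0 A *+ i' + row 1 A *+ j' + row 2 A *+ k' -> [/\ i = i', j = j' & k = k'].
Proof.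
move=> fA e.
pose c (i j k : nat) : 'rV[R]_3 := \row_l [:: i%:R; j%:R; k%:R]`_l.
have cA a b d : c a b d *m map_mx intr A =
    map_mx intr (row 0 A *+ a + row 1 A *+ b + row 2 A *+ d).
  apply/rowP => l; rewrite !mxE !big_ord_recr big_ord0 /= !mxE add0r.
  have hM (z : int) (n : nat) : (z *+ n)%:~R = n%:R * z%:~R :> R.
    by rewrite -[z *+ n]mulr_natl intrM natz.
  rewrite !mulmxnE !mxE !intrD !hM.
  by congr (_ * (A _ _)%:~R + _ * (A _ _)%:~R + _ * (A _ _)%:~R); apply/val_inj.
have := congr1 (map_mx (intr : int -> R)) e; rewrite -!cA => /(row_free_inj fA) /rowP h.
have := h 0; have := h 1; have := h 2; rewrite !mxE /=.
by do 3!(move=> /eqP; rewrite eqr_nat => /eqP->).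
Qed.

Lemma exists_notin k (B : seq 'rV[int]_k.+1) : exists x, x \notin B.
Proof.
apply: contrapT => /forallNP h.
pose X := [seq delta_mx 0 0 *+ m : 'rV[int]_k.+1 | m <- iota 0 (size B).+1].
have uX : uniq X.
  rewrite map_inj_uniq ?iota_uniq // => m n /rowP/(_ 0).
  by rewrite !mulmxnE !mxE eqxx /= => /eqP; rewrite eqr_nat => /eqP.
have : (size X <= size B)%N.
  by apply: uniq_leq_size => // x _; have /negP := h x; rewrite negbK.
by rewrite size_map size_iota ltnn.
Qed.

(** * Loops at a recurrent state and their drift *)

Section Transience.
Variables (R : archiRcfType) (S : finType) (next : S -> bool -> S) (k : nat).
Variables (dir : S -> 'rV[int]_k) (q : S).
Let en := endstate next.
Let dp := disp next dir.
Hypothesis q_return : forall w, exists v, en (en q w) v = q.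

(** Repeating [u] [size w] times and [w] [size u] times gives loops of equal length; [v] is the
    difference of their displacements. A linear form vanishes on all gaps exactly when its values on
    loops are proportional to the lengths. *)
Definition loop_gap (v : 'rV[int]_k) := exists u w,
  [/\ en q u = q, en q w = q & v = dp q w *+ size u - dp q u *+ size w].

Lemma loop_power w m : en q w = q ->
  exists v, [/\ en q v = q, size v = (m * size w)%N & dp q v = dp q w *+ m].
Proof.
move=> e; elim: m => [|m [v [ev sv dv]]]; first by exists [::].
exists (w ++ v); rewrite /en endstate_cat -/en e /dp disp_cat -/dp -/en e dv ev.
by rewrite size_cat sv mulSn mulrS.
Qed.

Lemma loop_gap_pair v : loop_gap v -> exists u w,
  [/\ size u = size w, en q u = q, en q w = q & dp q w - dp q u = v].
Proof.
move=> [u [w [eu ew ->]]].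
have [u' [eu' su' du']] := loop_power (size w) eu.
have [w' [ew' sw' dw']] := loop_power (size u) ew.
by exists u', w'; rewrite su' sw' du' dw' mulnC.
Qed.

Section Drift.
Variable f : 'rV[int]_k -> R.
Hypothesis fD : {morph f : x y / x + y}.
Hypothesis f_gap : forall v, loop_gap v -> f v = 0.

Lemma drift_sub x y : f (x - y) = f x - f y.
Proof. by rewrite -{2}[x](subrK y) (fD (x - y)) addrK. Qed.

Lemma drift_mulrn x n : f (x *+ n) = f x * n%:R.
Proof.
elim: n => [|n IH]; last by rewrite mulrSr fD IH -natr1 mulrDr mulr1.
by rewrite mulr0n mulr0 -(subrr x) drift_sub subrr.
Qed.

(** Any word closes up to a loop by a return word that depends only on its end state, so the error
    takes finitely many values. *)
Lemma displacement_drift : exists c K : R, forall w,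
  `|f (dp q w) - c * (size w)%:R| <= K.
Proof.
have [w1 e1] := q_return [:: true].
(* The loop that defines the slope [c] must be nonempty. *)
pose w0 := true :: w1; have e0 : en q w0 = q by [].
pose c := f (dp q w0) / (size w0)%:R.
have loopE w : en q w = q -> f (dp q w) = c * (size w)%:R.
  move=> ew; have : f (dp q w *+ size w0 - dp q w0 *+ size w) = 0.
    by apply: f_gap; exists w0, w.
  rewrite drift_sub !drift_mulrn => /eqP; rewrite subr_eq0 => /eqP h.
  have s0 : (size w0)%:R != 0 :> R by rewrite pnatr_eq0.
  by rewrite /c mulrAC -h mulfK.
pose back s := if pselect (exists v, en s v = q) is left h then sval (cid h) else [::].
exists c, (\sum_s `|f (dp s (back s)) - c * (size (back s))%:R|) => w.
have eb : en (en q w) (back (en q w)) = q.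
  by rewrite /back; case: pselect => [h|/(_ (q_return w))//]; case: cid.
rewrite (bigD1 (en q w)) //=; set s := en q w in eb *.
rewrite ler_wpDr ?sumr_ge0 //.
have := loopE (w ++ back s); rewrite /en endstate_cat -/en eb => /(_ erefl).
rewrite /dp disp_cat -/dp -/(en q w) -/s fD size_cat natrD mulrDr => h.
rewrite (_ : f (dp q w) - _ = - (f (dp s (back s)) - c * (size (back s))%:R)) ?normrN //.
by lra.
Qed.

Lemma drift_escape e (x0 : 'rV[int]_k) (B : R) : f e != 0 ->
  exists x : 'rV[int]_k, B < `|f x| /\ forall w, x0 + dp q w != x.
Proof.
move=> fe; have [c [K hK]] := displacement_drift.
pose m := (Num.truncn ((`|B| + `|f x0| + K) / `|f e|)).+1.
have fm : `|B| + `|f x0| + K < `|f e| * m%:R.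
  by rewrite mulrC -ltr_pdivrMr ?normr_gt0 // truncnS_gt.
(* The sign puts [f x] on the side opposite to the drift, beyond the bounded error. *)
exists (if (0 <= c) == (0 <= f e) then - (e *+ m) else e *+ m).
have fN x : f (- x) = - f x by rewrite -sub0r drift_sub -(subrr x) drift_sub subrr sub0r.
split.
  have -> : `|f (if (0 <= c) == (0 <= f e) then - (e *+ m) else e *+ m)| = `|f e| * m%:R.
    by case: ifP; rewrite ?fN drift_mulrn ?normrN normrM (ger0_norm (ler0n _ m)).
  have K0 : 0 <= K by apply: le_trans (hK [::]).
  by have := ler_norm B; have := normr_ge0 (f x0); lra.
move=> w; apply/eqP => h; have := congr1 f h; rewrite fD.
have := hK w; have : 0 <= (size w)%:R :> R by [].
move: (size w)%:R (f (dp q w)) => n y n0 /ler_normlP[h1 h2].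
have := ler_norm (f x0); have := ler_norm (- f x0); rewrite normrN.
have := normr_ge0 B; move: fm.
case: (leP 0 c) => c0; case: (leP 0 (f e)) => e0 /=; rewrite ?fN drift_mulrn.
- by rewrite (ger0_norm e0); have := mulr_ge0 c0 n0; lra.
- by rewrite (ltr0_norm e0); have := mulr_ge0 c0 n0; lra.
- by rewrite (ger0_norm e0); have := mulr_le0_ge0 (ltW c0) n0; lra.
- by rewrite (ltr0_norm e0); have := mulr_le0_ge0 (ltW c0) n0; lra.
Qed.
End Drift.
End Transience.

Lemma exists_rarely_hit (R : archiRcfType) (S : finType) (next : S -> bool -> S)
    (dir : S -> 'rV[int]_3) q (x0 : 'rV[int]_3) (bad : seq 'rV[int]_3) :
  (forall w, exists v, endstate next (endstate next q w) v = q) ->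
  exists x, x \notin bad /\ forall M, hit_prob next dir R M x q x0 <= 2^-1.
Proof.
move=> qr.
case: (pselect (exists2 phi : 'cV[R]_3, phi != 0 &
    forall v, loop_gap next dir q v -> map_mx intr v *m phi = 0)).
  move=> [phi phi0 hphi].
  pose f (v : 'rV[int]_3) : R := (map_mx intr v *m phi) 0 0.
  have fD : {morph f : x y / x + y}.
    by move=> x y; rewrite /f map_mxD mulmxDl mxE.
  have [i phii] : exists i, phi i 0 != 0.
    apply: contrapT => /forallNP h; move/eqP: phi0; apply; apply/colP => i.
    by have /negP/negPn/eqP -> := h i; rewrite mxE.
  have fe : f (delta_mx 0 i) != 0.
    by rewrite /f map_delta_mx -rowE mxE.
  have f0 v : loop_gap next dir q v -> f v = 0.
    by move=> /hphi; rewrite /f => ->; rewrite mxE.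
  (* The bound dominates [f] in absolute value on all of [bad], which keeps [x] out of it. *)
  have [x [fx xw]] := drift_escape qr fD f0 x0 (\sum_(y <- bad) `|f y|) fe.
  exists x; split.
    apply/negP => xbad; move: fx; rewrite ltNge => /negP; apply.
    rewrite (perm_big (x :: rem x bad)) ?big_cons ?lerDl ?sumr_ge0 //.
    exact: perm_to_rem.
  move=> M; apply: (@le_trans _ _ 0); last by rewrite invr_ge0.
  rewrite -(average_cst M 0); apply: le_average => w _.
  by case: visitsP => // -[t _] /eqP; rewrite (negbTE (xw _)).
move=> nphi.
have [phi phi0|A gapA freeA] :=
    @exists_independent_rows R 3 (loop_gap next dir q) _ 3 (leqnn 3).
  apply: contrapT => h; apply: nphi; exists phi => // v gv.
  by apply: contrapT => /eqP h'; apply: h; exists v.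
have [u1 [v1 [s1 lu1 lv1 d1]]] := loop_gap_pair (gapA 0).
have [u2 [v2 [s2 lu2 lv2 d2]]] := loop_gap_pair (gapA 1).
have [u3 [v3 [s3 lu3 lv3 d3]]] := loop_gap_pair (gapA 2).
have half : 0 < 2^-1 :> R by rewrite invr_gt0.
have := @hit_prob_far_le R S next _ dir q u1 v1 u2 v2 u3 v3 s1 s2 s3 lu1 lv1 lu2 lv2 lu3 lv3.
rewrite d1 d2 d3 => /(_ _ qr _ half)[|K hK].
  by move=> i j k i' j' k'; exact: row_free3_nat freeA.
(* Only finitely many cells can be reached in fewer than [K] steps. *)
pose near := [seq x0 + disp next dir q w | n <- iota 0 K, w <- words n].
have [x] := exists_notin (bad ++ near); rewrite mem_cat negb_or => /andP[xb xn].
exists x; split => //; apply: hK => w wK; apply: contra xn => /eqP <-.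
apply/allpairsPdep; exists (size w), w; split; rewrite ?mem_iota ?mem_words //.
Qed.

Local Open Scope classical_set_scope.
Local Open Scope ring_scope.

(** * Random bits and robots *)

Section RandomBits.
Context (R : realType) (d : measure_display) (T : measurableType d).
Variables (P : probability T R) (xi : nat -> {mfun T >-> bool}).
Hypothesis hxi : random_bits P xi.

Definition bits_upto (f : nat -> bool) n := [seq f i | i <- iota 1 n].

Lemma bits_uptoS f n : bits_upto f n.+1 = rcons (bits_upto f n) (f n.+1).
Proof. by rewrite /bits_upto -[n.+1]addn1 iotaD map_cat cats1 add1n addn1. Qed.

Lemma size_bits_upto f n : size (bits_upto f n) = n.
Proof. by rewrite size_map size_iota. Qed.

Let word n w := bits_upto (fun t => xi t w) n.

Lemma probability_word_eq (u : seq bool) :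
  measurable [set w | word (size u) w = u] /\
  P [set w | word (size u) w = u] = ((2 ^+ size u)^-1)%:E.
Proof.
pose J := [fset i in iota 1 (size u)]%fset.
pose A i := [set nth false u i.-1].
have uE : [set w | word (size u) w = u] = \bigcap_(i in [set` J]) (xi i @^-1` A i).
  apply/seteqP; split => w /=.
    move=> e i /=; rewrite inE mem_iota add1n => /andP[i0 iu].
    have iu' : (i.-1 < size u)%N by case: i i0 iu.
    have := congr1 (nth false ^~ i.-1) e.
    rewrite /A /= /word (nth_map 0%N) ?size_iota // nth_iota // add1n => <-.
    by rewrite prednK.
  move=> h; apply: (@eq_from_nth _ false); rewrite /word size_bits_upto // => i iu.
  rewrite (nth_map 0%N) ?size_iota // nth_iota // add1n.
  by have := h i.+1; apply; rewrite /= inE mem_iota add1n.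
have mA i : measurable (xi i @^-1` A i).
  by rewrite -[X in measurable X]setTI; exact: (measurable_funP (xi i)).
split.
  rewrite uE; apply: fin_bigcap_measurable => // i _; exact: mA.
rewrite uE hxi.1 //; last first.
  by move=> i /=; rewrite inE mem_iota => /andP[].
have -> : (\prod_(i <- J) P (xi i @^-1` A i) = \prod_(i <- J) (2^-1)%:E)%E.
  apply: eq_big_seq => i; rewrite inE mem_iota => /andP[i0 _].
  exact: hxi.2.
rewrite prodEFin (perm_big (iota 1 (size u))); last first.
  by apply: uniq_perm; rewrite ?fset_uniq ?iota_uniq // => i; rewrite inE.
by rewrite big_const_seq count_predT size_iota iter_mulr mulr1 exprVn.
Qed.

(** The prefix serves the induction on [n], which splits the event by the bit that follows [u]. *)
Lemma probability_word_prefix (u : seq bool) n (B : pred (seq bool)) :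
  let E := [set w | word (size u) w = u /\ B (word (size u + n) w)] in
  measurable E /\
  P E = (average n (fun v => (B (u ++ v))%:R) / 2 ^+ size u)%:E.
Proof.
elim: n u => [|n IH] u /=.
  rewrite addn0 average0 cats0.
  have [mu Pu] := probability_word_eq u.
  case Bu : (B u).
    have -> : [set w | word (size u) w = u /\ B (word (size u) w)] =
        [set w | word (size u) w = u].
      by apply/seteqP; split => w /=; [case|move=> e; rewrite e].
    by rewrite mul1r.
  have -> : [set w | word (size u) w = u /\ B (word (size u) w)] = set0.
    by apply/seteqP; split => w //= [->]; rewrite Bu.
  by rewrite measure0 mul0r.
have [mt Pt] := IH (rcons u true); have [mf Pf] := IH (rcons u false).
have -> : [set w | word (size u) w = u /\ B (word (size u + n.+1) w)] =
   [set w | word (size (rcons u true)) w = rcons u true /\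
      B (word (size (rcons u true) + n) w)] `|`
   [set w | word (size (rcons u false)) w = rcons u false /\
      B (word (size (rcons u false) + n) w)].
  apply/seteqP; split => w /=; rewrite !size_rcons /word bits_uptoS addSnnS.
    by case=> -> hB; case: (xi _ w); [left|right].
  by case=> -[/rcons_inj[-> _]].
split; first exact: measurableU.
rewrite measureU //; last first.
  apply/seteqP; split => w //= [[+ _] [+ _]]; rewrite !size_rcons /word => ->.
  by move=> /rcons_inj[].
rewrite [X in (X + _)%E]Pt [X in (_ + X)%E]Pf -EFinD averageS !size_rcons exprS.
under eq_average do rewrite cat_rcons.
under [X in (_ + X / _)%:E]eq_average do rewrite cat_rcons.
congr EFin; have h : (2 ^+ size u : R) != 0 by rewrite expf_neq0 // pnatr_eq0.
by field.
Qed.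

Lemma probability_word n (B : pred (seq bool)) :
  measurable [set w | B (word n w)] /\
  P [set w | B (word n w)] = (average n (fun v => (B v)%:R))%:E.
Proof.
have [] := probability_word_prefix [::] n B; rewrite /= add0n expr0 divr1.
have -> : [set w | word 0 w = [::] /\ B (word n w)] = [set w | B (word n w)].
  by apply/seteqP; split => w //= [].
by [].
Qed.

End RandomBits.

(** * Robots without stones as automaton walks *)

Section Robot.
Variables (k : nat) (r : robot k 0).

Definition robot_next (q : rb_state r) (b : bool) : rb_state r :=
  rb_trans q [tuple of [:: false; b]].

Let pos_of := disp robot_next (@rb_dir k 0 r).

Lemma step_observation (c : config r) b :
  rb_trans (cf_state c) (observation set0 c b) = robot_next (cf_state c) b.
Proof.
congr rb_trans; apply: val_inj => /=; rewrite in_set0.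
by rewrite (size0nil (s := map _ _)) // size_map size_enum_ord.
Qed.

Lemma run_word f n :
  [/\ cf_time (run set0 r f n) = n.+1,
   cf_state (run set0 r f n) = endstate robot_next (rb_init r) (bits_upto f n) &
   cf_pos (run set0 r f n) = pos_of (rb_init r) (bits_upto f n)].
Proof.
elim: n => // n [t s p]; rewrite /run iterS -/(run set0 r f n) bits_uptoS -cats1.
split; first by rewrite /= t.
  by rewrite /step /= step_observation s t endstate_cat.
by rewrite /step /= p s /pos_of disp_cat /= addr0.
Qed.

Lemma visits_run x f n :
  visits robot_next (@rb_dir k 0 r) x (rb_init r) 0 (bits_upto f n) <->
  exists2 m, (m <= n)%N & cf_pos (run set0 r f m) = x.
Proof.
have tk m : (m <= n)%N -> take m (bits_upto f n) = bits_upto f m.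
  by move=> mn; rewrite /bits_upto -map_take take_iota (minn_idPl mn).
split.
  move=> /visitsP[m]; rewrite size_bits_upto => mn; rewrite add0r tk // => <-.
  by exists m => //; have [_ _ ->] := run_word f m.
move=> [m mn <-]; apply/visitsP; exists m; rewrite ?size_bits_upto //.
by rewrite add0r tk //; have [_ _ ->] := run_word f m.
Qed.

Context (R : realType) (d : measure_display) (T : measurableType d).
Variables (P : probability T R) (xi : nat -> {mfun T >-> bool}).
Hypothesis hxi : random_bits P xi.

Let hit n x : R := hit_prob robot_next (@rb_dir k 0 r) R n x (rb_init r) 0.

(** The visit is the increasing union of events decided by the first [n] bits, so continuity from
    below applies. *)
Lemma probability_visit (x : cell k) (c : R) :
  let V := [set w | exists m, cf_pos (run set0 r (fun t => xi t w) m) = x] in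
  measurable V /\
  (forall n, ((hit n x)%:E <= P V)%E) /\
  ((forall n, hit n x <= c) -> (P V <= c%:E)%E).
Proof.
move=> V.
pose B := visits robot_next (@rb_dir k 0 r) x (rb_init r) 0.
pose F n := [set w | B (bits_upto (fun t => xi t w) n)].
have FP n := probability_word hxi n B.
have VE : V = \bigcup_n F n.
  apply/seteqP; split => w.
    by move=> [m e]; exists m => //; apply/visits_run; exists m.
  by move=> [n _ /visits_run[m _ e]]; exists m.
have mF n : measurable (F n) by have [] := FP n.
have mV : measurable (\bigcup_n F n) by apply: bigcup_measurable.
rewrite VE; split; [exact: mV|split=> [n|hc]].
  have [_ <-] := FP n; apply: le_measure; rewrite ?inE.
  - exact: (mF n).
  - exact: mV.
  - by move=> w hw; exists n.
have ndF : {homo F : n m / (n <= m)%N >-> (n <= m)%O}.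
  move=> n m nm; apply/subsetPset => w /visits_run[i im e].
  by apply/visits_run; exists i => //; apply: leq_trans nm.
apply: cvge_le (nondecreasing_cvg_mu (mu := P) mF mV ndF).
apply: nearW => n; rewrite [leLHS](FP n).2 lee_fin; exact: hc.
Qed.

Lemma covers_hit_prob :
  covers P set0 r xi <->
  forall x (e : R), 0 < e -> exists n, 1 - e <= hit n x.
Proof.
split=> [cov x e e0|H x].
  apply: contrapT => /forallNP h.
  have [_ [_ vle]] := probability_visit x (1 - e).
  move: vle; rewrite cov => vle.
  have : (1%:E <= (1 - e)%:E)%E.
    by apply: vle => n; apply/ltW; rewrite ltNge; exact/negP/h.
  by rewrite lee_fin leNgt ltrBlDr ltrDl e0.
have [mV [h _]] := probability_visit x 0.
apply/eqP; rewrite eq_le probability_le1 //=.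
apply/lee_addgt0Pr => e e0; have [n hn] := H x e e0.
apply: (@le_trans _ _ ((hit n x)%:E + e%:E)%E); last by rewrite leeD2r.
by rewrite -EFinD lee_fin -lerBlDr.
Qed.

End Robot.

(** * A robot covering the plane *)

(* A block passes through [inl false] and [inl true], which move by [e_1] and
   back, then makes a horizontal and a vertical move; in [inr (axis, sign)] the
   bit [axis] tells these two moves apart. *)
Definition walker_state : finType := (bool + bool * bool)%type.

Definition walker_trans (q : walker_state) (w : 2.-tuple bool) : walker_state :=
  let b := last false w in
  match q with
  | inl false => inl true
  | inl true => inr (false, b)
  | inr (false, _) => inr (true, b)
  | inr (true, _) => inl false
  end.

Definition walker_dir (q : walker_state) : cell 2 :=
  match q with
  | inl false => delta_mx 0 0
  | inl true => - delta_mx 0 0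
  | inr (axis, sign) =>
      let e := delta_mx 0 (if axis then 1 else 0) in if sign then e else - e
  end.

Lemma walker_dirP q : unit_moves (walker_dir q).
Proof.
case: q => [[]|[i []]] /=; try (by exists 0; left); try (by exists 0; right).
  by exists (if i then 1 else 0); left.
by exists (if i then 1 else 0); right.
Qed.

Definition walker : robot 2 0 :=
  @Robot 2 0 walker_state (inl false) walker_trans walker_dir
    (fun=> [tuple]) walker_dirP.

Section Walker.
Variable R : realType.

Let hit := hit_prob (@robot_next 2 walker) (@rb_dir 2 0 walker) R.

Lemma hit_walker_near t x (a z : cell 2) : z = x \/ z = x - delta_mx 0 0 ->
  a 0 0 - z 0 0 = 0 -> a 0 1 - z 0 1 = 0 -> hit t.+1 x (inl false) a = 1.
Proof.
move=> zx h0 h1; rewrite /hit /hit_prob -[RHS](@average_cst _ t.+1).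
apply: eq_average => -[|b w] //= _.
have -> : a = z.
  apply/rowP => i; case: (unliftP 0 i) => [j ->|->]; last exact/subr0_eq.
  by rewrite (ord1 j) (_ : lift 0 0 = 1) ?(subr0_eq h1) //; exact/val_inj.
case: zx => ->; first by rewrite eqxx.
rewrite (subrK (delta_mx 0 0) x : x - _ + walker_dir (inl false) = x).
by case: w => [|? ?]; rewrite /= eqxx ?orbT.
Qed.

(** Four steps per block, and one more for the excursion that takes the robot from [x - e_1] to
    [x]. *)
Lemma walker_hit_block n x (a z : cell 2) : z = x \/ z = x - delta_mx 0 0 ->
  hit0 R n (a 0 0 - z 0 0) (a 0 1 - z 0 1) <= hit (4 * n + 1) x (inl false) a.
Proof.
move=> zx; elim: n a => [|n IH] a.
  rewrite muln0 add0n /=; case: ifP => [/andP[/eqP h0 /eqP h1]|_].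
    by rewrite (hit_walker_near _ zx).
  by apply: average_ge0 => w; apply: ler0n.
rewrite (_ : (4 * n.+1 + 1)%N = (4 * n + 1).+4); last by lia.
rewrite hit0S; case: ifP => [/andP[/eqP h0 /eqP h1]|_].
  by rewrite (hit_walker_near _ zx).
have hS t s b := @hit_probS_ge _ (@robot_next 2 walker) _ (@rb_dir 2 0 walker) R t x s b.
move: (4 * n + 1)%N IH => t IH.
pose sg (b : bool) (e : cell 2) := if b then e else - e.
have H1 := hS t.+3 (inl false) a; rewrite /= -/hit in H1.
have H2 := hS t.+2 (inl true) (a + delta_mx 0 0); rewrite /= -/hit addrK in H2.
have H3 b := hS t.+1 (inr (false, b)) a; rewrite /= -/hit in H3.
have H4 b b' := hS t (inr (true, b')) (a + sg b (delta_mx 0 0)); rewrite /= -/hit in H4.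
have I b b' := IH (a + sg b (delta_mx 0 0) + sg b' (delta_mx 0 1)).
have := H3 true; have := H3 false.
have := H4 true true; have := H4 true false; have := H4 false true; have := H4 false false.
have := I true true; have := I true false; have := I false true; have := I false false.
rewrite /sg !mxE /= ?addr0 ?subr0 ?oppr0 ?addr0 /avg4.
rewrite !(addrAC _ _ (- z 0 0)) !(addrAC _ _ (- z 0 1)).
move: (a 0 0 - z 0 0) (a 0 1 - z 0 1) => i j; clear I IH H3 H4 hS.
lra.
Qed.

End Walker.

(** With [b] the parity of [i + j], moving back by [b e_1] leads into the lattice spanned by the
    diagonal steps. *)
Lemma even_shift (i j : int) :
  exists p q (b : bool), - (i - b%:R) = p + q /\ - j = p - q.
Proof.
have := divz_eq (i + j) 2; have := modz_ge0 (i + j) (isT : 2 != 0 :> int).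
have := ltz_pmod (i + j) (isT : 0 < 2 :> int).
move: ((i + j) %/ 2)%Z ((i + j) %% 2)%Z => m r r2 r0 e.
case: (eqVneq r 0) => [r00|rn0].
  by exists (- m), (m - i), false; split; lia.
by exists (- m), (m - i + 1), true; split; lia.
Qed.

Lemma walker_covers (R : realType) (d : measure_display) (T : measurableType d)
    (P : probability T R) (xi : nat -> {mfun T >-> bool}) :
  random_bits P xi -> covers P set0 walker xi.
Proof.
move=> hxi; apply/(covers_hit_prob walker hxi) => x e e0.
have [p [q [b [hp hq]]]] := even_shift (x 0 0) (x 0 1).
pose z : cell 2 := if b then x - delta_mx 0 0 else x.
have zx : z = x \/ z = x - delta_mx 0 0 by rewrite /z; case: (b); [right|left].
have z0 : - z 0 0 = p + q by rewrite -hp /z; case: (b); rewrite ?mxE ?subr0.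
have z1 : - z 0 1 = p - q by rewrite -hq /z; case: (b); rewrite ?mxE ?subr0.
have [n hn] := surely_hit_even p q e0.
exists (4 * n + 1)%N; apply: (le_trans hn).
rewrite -z0 -z1 -[- z 0 0]add0r -[- z 0 1]add0r.
by have := @walker_hit_block R n x 0 z zx; rewrite !mxE.
Qed.

(** * No robot covers the space *)

Lemma hit_prob_mono (R : realFieldType) (S : finType) (next : S -> bool -> S)
    (V : zmodType) (dir : S -> V) m n x s a :
  hit_prob next dir R m x s a <= hit_prob next dir R (m + n) x s a.
Proof.
rewrite /hit_prob average_cat; apply: le_average => u _.
rewrite -[leLHS](@average_cst _ n); apply: le_average => v _.
by rewrite ler_nat visits_cat; case: (visits next dir x s a u).
Qed.

(** With probability [2 ^- size w] the bits begin with [w]; the walk then restarts from the end of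
    [w] without having met [x]. *)
Lemma hit_prob_avoid (R : realFieldType) (S : finType) (next : S -> bool -> S)
    (V : zmodType) (dir : S -> V) w n x s a :
  ~~ visits next dir x s a w ->
  (1 - hit_prob next dir R n x (endstate next s w) (a + disp next dir s w)) / 2 ^+ size w
  <= 1 - hit_prob next dir R (size w + n) x s a.
Proof.
have miss m s' a' : 1 - hit_prob next dir R m x s' a' =
    average m (fun w => (~~ visits next dir x s' a' w)%:R).
  rewrite /hit_prob -[X in X - _](@average_cst R m) -mulN1r -averageZ -averageD.
  by apply: eq_average => v _; case: visits; rewrite /= ?mulr0 ?mulr1 ?addr0 ?subrr.
move=> /negbTE xw; rewrite !miss.
apply: le_trans (average_prefix w n (F := fun w => (~~ visits next dir x s a w)%:R) _) => //.
rewrite ler_pM2r ?invr_gt0 ?exprn_gt0 //; apply: le_average => v _.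
by rewrite visits_cat xw.
Qed.

Lemma robot3_not_covers (R : realType) (d : measure_display) (T : measurableType d)
    (P : probability T R) (xi : nat -> {mfun T >-> bool}) (r : robot 3 0) :
  random_bits P xi -> ~ covers P set0 r xi.
Proof.
move=> hxi /(covers_hit_prob r hxi) cov.
have [w0 rec] := exists_recurrent_state (@robot_next 3 r) (rb_init r).
pose dp := disp (@robot_next 3 r) (@rb_dir 3 0 r) (rb_init r).
have [x [xbad xhit]] := @exists_rarely_hit R _ _ (@rb_dir 3 0 r) _ (dp w0)
   [seq dp (take t w0) | t <- iota 0 (size w0).+1] rec.
have xw0 : ~~ visits (@robot_next 3 r) (@rb_dir 3 0 r) x (rb_init r) 0 w0.
  apply: contra xbad => /visitsP[t tw]; rewrite add0r => <-.
  by apply/mapP; exists t => //; rewrite mem_iota.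
(* The robot misses [x] with probability at least [2 ^- size w0 / 2], so half of that contradicts
   covering. *)
have p0 : 0 < 2 ^- size w0 / 4 :> R by rewrite divr_gt0 ?invr_gt0 ?exprn_gt0.
have [n hn] := cov x _ p0.
have h1 := hit_prob_avoid R n xw0; rewrite add0r in h1.
have := hit_prob_mono R (@robot_next 3 r) (@rb_dir 3 0 r) n (size w0) x (rb_init r) 0.
rewrite addnC => h2.
have h3 := xhit n.
have e0 : 0 < 2 ^- size w0 :> R by rewrite invr_gt0 exprn_gt0.
have h4 : 2^-1 * 2 ^- size w0 <= (1 - hit_prob (@robot_next 3 r) (@rb_dir 3 0 r) R n x
    (endstate (@robot_next 3 r) (rb_init r) w0) (dp w0)) / 2 ^+ size w0.
  by rewrite ler_pM2r //; lra.
have := le_trans h4 h1; lra.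
Qed.

Theorem mainTheorem1 (R : realType) (d : measure_display)
    (T : measurableType d) (P : probability T R)
    (xi : nat -> {mfun T >-> bool}) (hxi : random_bits P xi) :
  (exists r : robot 2 0, covers P set0 r xi) /\
  ~ (exists r : robot 3 0, covers P set0 r xi).
Proof.
split; first by exists walker; exact: walker_covers.
by case=> r; exact: robot3_not_covers.
Qed.
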